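(* Let $A$ be a Buchsbaum local ring with maximal ideal $\mathfrak{m}$ and $d = \dim A \geq 1$, and assume that the index $\ell_A((Q:\mathfrak{m})/Q)$ of reducibility of $Q$ is independent of the choice of a parameter ideal $Q$ in $A$. If $\mathrm{e}(A) > 1$, then the equality $I^2 = QI$ holds true for every parameter ideal $Q$ in $A$, where $I = Q : \mathfrak{m}$.
   Context: A parameter ideal in $A$ is an ideal generated by a system of parameters. A Noetherian local ring $A$ with maximal ideal $\mathfrak{m}$ and $d = \dim A\geq 1$ is a Buchsbaum ring if the difference $\ell_A(A/Q) - \mathrm{e}^0_Q(A)$ is independent of the choice of a parameter ideal $Q$, where $\mathrm{e}^0_Q(A)$ is the multiplicity of $A$ with respect to $Q$; equivalently, every system of parameters $x_1,\dots,x_d$ satisfies $(x_1,\dots,x_{i-1}):x_i = (x_1,\dots,x_{i-1}):\mathfrak{m}$ for all $1\leq i\leq d$. $\mathrm{e}(A) = \mathrm{e}^0_{\mathfrak{m}}(A)$ is the multiplicity of $A$ with respect to $\mathfrak{m}$; $\ell_A$ denotes length; $Q:\mathfrak{m} = \{x\in A \mid x\mathfrak{m}\subseteq Q\}$. *)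

(* Defs.v *)
From HB Require Import structures.
From mathcomp Require Import all_boot all_order all_algebra.
From mathcomp Require Import boolp classical_sets.

Set Implicit Arguments.
Unset Strict Implicit.
Unset Printing Implicit Defensive.

Import Order.TTheory GRing.Theory Num.Theory.

Local Open Scope classical_set_scope.
Local Open Scope ring_scope.

Section Ideals.
Variable A : comNzRingType.
Implicit Types (I J Q m : set A).

Definition is_ideal I : Prop :=
  [/\ I 0,
      forall x y, I x -> I y -> I (x + y)
    & forall a x, I x -> I (a * x)].

Definition ideal_gen (S : set A) : set A := smallest is_ideal S.

Definition ideal_mul I J : set A :=
  ideal_gen [set a * b | a in I & b in J].

(* I ^ 0 is the unit ideal. *)
Definition ideal_exp I (n : nat) : set A := iter n (ideal_mul I) setT.

Definition ideal_colon I J : set A := [set x | forall y, J y -> I (x * y)].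

Definition prime_ideal P : Prop :=
  [/\ is_ideal P, ~ P 1 & forall x y : A, P (x * y) -> P x \/ P y].

Definition maximal_ideal m : Prop :=
  [/\ is_ideal m, ~ m 1 & forall J, is_ideal J -> ~ J 1 -> m `<=` J -> J = m].

Definition local_ring m : Prop :=
  maximal_ideal m /\ forall m', maximal_ideal m' -> m' = m.

(* The length of the A-module J / I, for ideals I included in J: submodules
   of J / I are written as ideals between I and J.  As [supremum] is taken in
   nat, the value is 0 when J / I has infinite length; this does not occur
   below, where A is Noetherian local and I contains a power of its maximal
   ideal. *)
Definition quot_length I J : nat :=
  supremum 0%N [set n : nat | exists L : nat -> set A,
    [/\ L 0%N = I, L n = J,
        forall i, (i <= n)%N -> is_ideal (L i)
      & forall i, (i < n)%N -> L i `<` L i.+1]].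

End Ideals.

Definition noetherian (A : comNzRingType) : Prop :=
  forall I : set A, is_ideal I ->
    exists s : seq A, I = ideal_gen [set x | x \in s].

(* The value is 0 if the lengths of the chains are unbounded, which is
   impossible in a Noetherian local ring. *)
Definition krull_dim (A : comNzRingType) : nat :=
  supremum 0%N [set n : nat | exists P : nat -> set A,
    (forall i, (i <= n)%N -> prime_ideal (P i)) /\
    (forall i, (i < n)%N -> P i `<` P i.+1)].

Section LocalRings.
Variable A : comNzRingType.
Implicit Types (I Q m : set A).

Definition system_of_parameters m (x : seq A) : Prop :=
  [/\ size x = krull_dim A,
      forall a, a \in x -> m a
    & exists k, ideal_exp m k `<=` ideal_gen [set a | a \in x]].

Definition parameter_ideal m Q : Prop :=
  exists x : seq A,
    system_of_parameters m x /\ Q = ideal_gen [set a | a \in x].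

(* The polynomial that agrees with n |-> l(A / I ^ n) for n large; a
   polynomial over rat with this property is unique. *)
Definition hilbert_samuel_poly I : {poly rat} :=
  xget 0 [set p : {poly rat} | exists N : nat, forall n : nat, (N <= n)%N ->
    p.[n%:R] = (quot_length (ideal_exp I n) setT)%:R].

(* e^0_I(A): if d = dim A, the Hilbert-Samuel polynomial has degree d and its
   leading coefficient is e^0_I(A) / d!. *)
Definition multiplicity I : rat :=
  (krull_dim A)`!%:R * (hilbert_samuel_poly I)`_(krull_dim A).

Definition buchsbaum m : Prop :=
  [/\ noetherian A, local_ring m, (1 <= krull_dim A)%N
    & forall Q Q', parameter_ideal m Q -> parameter_ideal m Q' ->
      (quot_length Q setT)%:R - multiplicity Q =
      (quot_length Q' setT)%:R - multiplicity Q'].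

End LocalRings.

(* Main.v *)
(* Let Q = (a_1, ..., a_d), a = a_i, P = (a_j : j <> i) and W = P : a.

   The Hilbert function of a parameter ideal is a sum over exponent vectors of colengths of ideals
   of leading coefficients, which decrease along divisibility; this makes it a polynomial and gives
   e(a^n, P) = n e(a, P).  Comparing lengths of A / (P + a^n A), the Buchsbaum property yields
   P : a^n = W and m W <= P, and the constancy of the index gives (Q + W) : m = Q : m.

   If x, y lie in I = Q : m and t in m, write x t = a u + p with p in P.  Were u a unit, m would be
   t A + W, which forces e(A) <= 1.  So u lies in m, and if x y = sum_j a_j z_j, then
   a (z_i t - u y) lies in P, whence z_i t lies in Q + W and z_i in (Q + W) : m = I.  Thus x y lies in Q I. *)

Require Import Defs.
From HB Require Import structures.
From mathcomp Require Import all_boot all_order all_algebra.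
From mathcomp Require Import boolp classical_sets.
From mathcomp Require Import zify ring.
From mathcomp Require Import polyrcf.

Set Implicit Arguments.
Unset Strict Implicit.
Unset Printing Implicit Defensive.

Import Order.TTheory GRing.Theory Num.Theory.

Local Open Scope classical_set_scope.
Local Open Scope ring_scope.

(** The Buchsbaum hypothesis speaks only of lengths and multiplicities of parameter ideals, so m W
    <= P has to be extracted from lengths, and this takes e(a^n, P) = n e(a, P) as an exact
    equality. Ordering monomials by degree computes the Hilbert function of (a, P) exactly, but for
    (a^n, P) the same coefficient ideals give just an upper bound. The matching lower bound appears
    once all d generators are raised to the power n.

    Multiplicities are handled as stable d-th differences of integer sequences; polynomials enter to
    meet the definition.

    For (Q + W) : m = Q : m, the parameter ideals Q = (a, P) and (a^2, P) are compared. W meets both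
    in P, so W/P contributes the same length to both, and multiplication by a carries ((Q + W) :
    m)/(Q + W) onto the rest of the socle modulo (a^2, P).

    If m = tA + W, then m W <= P gives m^j <= P + t^j A for j >= 2, so the Hilbert function of A/P
    grows by at most one per step. Dropping the d - 1 generators of P raises the degree of this
    bound by one each time and keeps its normalized leading coefficient 1; hence e(A) <= 1. *)

(** * Sums, products, powers and colons of ideals *)

Section IdealTheory.
Variable A : comNzRingType.
Implicit Types (I J K L M P Q m : set A) (s : seq A).

Lemma ideal0 I : is_ideal I -> I 0. Proof. by case. Qed.

Lemma idealD I x y : is_ideal I -> I x -> I y -> I (x + y).
Proof. by case=> _ + _; apply. Qed.

Lemma idealM I a x : is_ideal I -> I x -> I (a * x).
Proof. by case=> _ _; apply. Qed.

Lemma idealMr I a x : is_ideal I -> I x -> I (x * a).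
Proof. by rewrite mulrC; exact: idealM. Qed.

Lemma idealN I x : is_ideal I -> I x -> I (- x).
Proof. by move=> hI Ix; rewrite -mulN1r; apply: idealM. Qed.

Lemma idealB I x y : is_ideal I -> I x -> I y -> I (x - y).
Proof. by move=> hI Ix Iy; apply: idealD => //; apply: idealN. Qed.

Lemma ideal_sum I (T : Type) (r : seq T) (p : pred T) (F : T -> A) :
  is_ideal I -> (forall i, p i -> I (F i)) -> I (\sum_(i <- r | p i) F i).
Proof.
move=> hI hF; apply: (big_ind I) => //; first exact: ideal0.
by move=> x y; apply: idealD.
Qed.

Lemma ideal_top I : is_ideal I -> I 1 -> I = setT.
Proof.
by move=> hI I1; rewrite predeqE => x; split=> // _; rewrite -(mulr1 x); apply: idealM.
Qed.

Lemma is_ideal_setT : is_ideal (@setT A). Proof. by []. Qed.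

Lemma is_idealI I J : is_ideal I -> is_ideal J -> is_ideal (I `&` J).
Proof.
move=> hI hJ; split; first by split; exact: ideal0.
  by move=> x y [Ix Jx] [Iy Jy]; split; apply: idealD.
by move=> a x [Ix Jx]; split; apply: idealM.
Qed.

Lemma gen_ideal (S : set A) : is_ideal (ideal_gen S).
Proof.
split.
- by move=> I [hI _]; apply: ideal0.
- by move=> x y Ix Iy I hI; apply: idealD (Ix I hI) (Iy I hI); case: hI.
- by move=> a x Ix I hI; apply: idealM (Ix I hI); case: hI.
Qed.

Lemma sub_gen (S : set A) : S `<=` ideal_gen S.
Proof. exact: sub_smallest. Qed.

Lemma gen_sub (S I : set A) : is_ideal I -> S `<=` I -> ideal_gen S `<=` I.
Proof. exact: smallest_sub. Qed.

(** The second summand is left as a difference, so that a membership proof names one witness and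
    ends with a ring identity; [addp] and [addmul] follow the same pattern. *)
Definition idsum I J : set A := [set x | exists2 y, I y & J (x - y)].

Definition addp I (a : A) : set A := [set x | exists c, I (x - a * c)].

Definition colon1 I (a : A) : set A := [set x | I (a * x)].

(* Locked: an unfolded [ideal_gen] is a product, which [apply:] would look into. *)
Definition seqid s : set A := locked (ideal_gen [set a | a \in s]).

Definition powid m n := ideal_exp m n.

Lemma is_ideal_idsum I J : is_ideal I -> is_ideal J -> is_ideal (idsum I J).
Proof.
move=> hI hJ; split.
- by exists 0; [exact: ideal0|rewrite subr0; exact: ideal0].
- move=> x y [x' Ix' Jx] [y' Iy' Jy]; exists (x' + y'); first exact: idealD.
  by rewrite opprD addrACA; apply: idealD.
- move=> a x [x' Ix' Jx]; exists (a * x'); first exact: idealM.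
  by rewrite -mulrBr; apply: idealM.
Qed.

Lemma idsum_subl I J : is_ideal J -> I `<=` idsum I J.
Proof. by move=> hJ x Ix; exists x => //; rewrite subrr; exact: ideal0. Qed.

Lemma idsum_subr I J : is_ideal I -> J `<=` idsum I J.
Proof. by move=> hI x Jx; exists 0; [exact: ideal0|rewrite subr0]. Qed.

Lemma idsum_lub I J K : is_ideal K -> I `<=` K -> J `<=` K -> idsum I J `<=` K.
Proof.
move=> hK IK JK x [y Iy Jxy]; rewrite -(subrK y x).
by apply: idealD => //; [apply: JK|apply: IK].
Qed.

Lemma idsumC I J : idsum I J = idsum J I.
Proof.
by apply/seteqP; split=> x [y Iy Jxy]; exists (x - y); rewrite // subKr.
Qed.

Lemma is_ideal_addp I a : is_ideal I -> is_ideal (addp I a).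
Proof.
move=> hI; split.
- by exists 0; rewrite mulr0 subr0; exact: ideal0.
- move=> x y [c Ix] [d Iy]; exists (c + d).
  by rewrite mulrDr opprD addrACA; apply: idealD.
- move=> b x [c Ix]; exists (b * c).
  by rewrite mulrCA -mulrBr; apply: idealM.
Qed.

Lemma addp_sub I a : I `<=` addp I a.
Proof. by move=> x Ix; exists 0; rewrite mulr0 subr0. Qed.

Lemma addp_mem I a : is_ideal I -> addp I a a.
Proof. by move=> hI; exists 1; rewrite mulr1 subrr; exact: ideal0. Qed.

Lemma addp_lub I a K : is_ideal K -> I `<=` K -> K a -> addp I a `<=` K.
Proof.
move=> hK IK Ka x [c /IK Kx]; rewrite -(subrK (a * c) x).
by apply: idealD => //; apply: idealMr.
Qed.

Lemma is_ideal_colon1 I a : is_ideal I -> is_ideal (colon1 I a).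
Proof.
move=> hI; split; rewrite /colon1 /=.
- by rewrite mulr0; exact: ideal0.
- by move=> x y Ix Iy; rewrite mulrDr; apply: idealD.
- by move=> b x Ix; rewrite mulrCA; apply: idealM.
Qed.

Lemma colon1_sub I a : is_ideal I -> I `<=` colon1 I a.
Proof. by move=> hI x Ix; apply: idealM. Qed.

Lemma is_ideal_colon I J : is_ideal I -> is_ideal (ideal_colon I J).
Proof.
move=> hI; split; rewrite /ideal_colon /=.
- by move=> y _; rewrite mul0r; exact: ideal0.
- by move=> x y Ix Iy z Jz; rewrite mulrDl; exact: idealD (Ix z Jz) (Iy z Jz).
- by move=> b x Ix z Jz; rewrite -mulrA; exact: idealM (Ix z Jz).
Qed.

Lemma colon_sub I J : is_ideal I -> I `<=` ideal_colon I J.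
Proof. by move=> hI x Ix y _; apply: idealMr. Qed.

Lemma seqidE s : seqid s = ideal_gen [set a | a \in s].
Proof. by rewrite /seqid -lock. Qed.

Lemma seqid_ideal s : is_ideal (seqid s).
Proof. by rewrite seqidE; exact: gen_ideal. Qed.

Lemma seqid_mem s a : a \in s -> seqid s a.
Proof. by rewrite seqidE => sa; apply: sub_gen. Qed.

Lemma seqid_sub s K : is_ideal K -> (forall a, a \in s -> K a) -> seqid s `<=` K.
Proof. by rewrite seqidE => hK sK; apply: gen_sub. Qed.

Lemma seqid_eq s s' : s =i s' -> seqid s = seqid s'.
Proof.
by move=> ss'; rewrite !seqidE; congr ideal_gen; apply: funext => x /=; rewrite ss'.
Qed.

Lemma seqid_nil : seqid [::] = [set 0].
Proof.
apply/seteqP; split; last by move=> x ->; exact: ideal0 (seqid_ideal _).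
apply: seqid_sub => //; split=> //=.
- by move=> x y -> ->; rewrite addr0.
- by move=> a x ->; rewrite mulr0.
Qed.

Lemma seqid_cons a s : seqid (a :: s) = addp (seqid s) a.
Proof.
apply/seteqP; split.
- apply: seqid_sub; first exact/is_ideal_addp/seqid_ideal.
  move=> b; rewrite inE => /orP[/eqP->|/seqid_mem/addp_sub//].
  exact/addp_mem/seqid_ideal.
- apply: addp_lub; [exact: seqid_ideal| |by apply: seqid_mem; rewrite inE eqxx].
  apply: seqid_sub; first exact: seqid_ideal.
  by move=> b sb; apply: seqid_mem; rewrite inE sb orbT.
Qed.

Lemma seqid_sum s x : seqid s x ->
  exists z : nat -> A, x = \sum_(i < size s) s`_i * z i.
Proof.
elim: s x => [|a s IH] x.
  by rewrite seqid_nil => ->; exists (fun=> 0); rewrite big_ord0.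
rewrite seqid_cons => -[c] /IH[z xE].
exists (fun i => if i is i'.+1 then z i' else c).
by rewrite big_ord_recl /= -xE addrC subrK.
Qed.

Lemma mul_ideal I J : is_ideal (ideal_mul I J).
Proof. exact: gen_ideal. Qed.

Lemma mul_mem I J x y : I x -> J y -> ideal_mul I J (x * y).
Proof. by move=> Ix Jy; apply: sub_gen; exists x => //; exists y. Qed.

Lemma mul_sub I J K : is_ideal K -> (forall x y, I x -> J y -> K (x * y)) ->
  ideal_mul I J `<=` K.
Proof. by move=> hK h; apply: gen_sub => // _ [x Ix [y Jy <-]]; apply: h. Qed.

Lemma mul_subS I I' J J' : I `<=` I' -> J `<=` J' ->
  ideal_mul I J `<=` ideal_mul I' J'.
Proof.
move=> II' JJ'; apply: mul_sub; first exact: mul_ideal.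
by move=> x y /II' + /JJ'; apply: mul_mem.
Qed.

Lemma powid_ideal m n : is_ideal (powid m n).
Proof. by case: n => [|n]; [exact: is_ideal_setT|exact: mul_ideal]. Qed.

Lemma powidS m n : powid m n.+1 = ideal_mul m (powid m n). Proof. by []. Qed.

Lemma powid1 m : is_ideal m -> powid m 1 = m.
Proof.
move=> hm; apply/seteqP; split.
- by apply: mul_sub => // x y mx _; apply: idealMr.
- by move=> x mx; rewrite -(mulr1 x); apply: mul_mem.
Qed.

Lemma powid_decr m n k : (n <= k)%N -> powid m k `<=` powid m n.
Proof.
elim: k n => [|k IH] n; first by rewrite leqn0 => /eqP->.
rewrite leq_eqVlt => /predU1P[->//|/IH h] x hx; apply: h; move: x hx.
by apply: mul_sub; [exact: powid_ideal|move=> x y _; apply: idealM; exact: powid_ideal].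
Qed.

Lemma powid_mulD m k j x y : powid m k x -> powid m j y -> powid m (k + j) (x * y).
Proof.
elim: k x y => [|k IH] x y; first by move=> _; apply: idealM; exact: powid_ideal.
move=> + jy; pose K := [set x | powid m (k.+1 + j) (x * y)].
suff: powid m k.+1 `<=` K by apply.
apply: mul_sub.
  split; rewrite /K /=.
  - by rewrite mul0r; exact: (ideal0 (powid_ideal m (k.+1 + j))).
  - by move=> a b Ka Kb; rewrite mulrDl; exact: (idealD (powid_ideal m (k.+1 + j)) Ka Kb).
  - by move=> a b Kb; rewrite -mulrA; exact: (idealM a (powid_ideal m (k.+1 + j)) Kb).
move=> a b ma kb; rewrite /K /= -mulrA; apply: mul_mem => //.
exact: IH.
Qed.

Lemma powid_addn m k j : powid m (k + j) `<=` ideal_mul (powid m k) (powid m j).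
Proof.
elim: k => [|k IH].
  by move=> x hx; rewrite -(mul1r x); apply: mul_mem.
apply: mul_sub; first exact: mul_ideal.
move=> a b ma /IH; pose K := [set b | ideal_mul (powid m k.+1) (powid m j) (a * b)].
suff: ideal_mul (powid m k) (powid m j) `<=` K by apply.
apply: mul_sub; first exact/is_ideal_colon1/mul_ideal.
by move=> x y kx jy; rewrite /K /= mulrA; apply: mul_mem => //; apply: mul_mem.
Qed.

Lemma powid_exp m n x : m x -> powid m n (x ^+ n).
Proof. by move=> mx; elim: n => // n IH; rewrite exprS; apply: mul_mem. Qed.

End IdealTheory.

(** * Lengths of quotients and the isomorphism theorems for them *)

Section Length.
Variable A : comNzRingType.
Implicit Types (I J K L M P : set A).

(** The indexed chains of [quot_length] in inductive form, so that concatenation, splitting and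
    transport along maps of ideals become inductions. *)
Inductive chain : set A -> set A -> nat -> Prop :=
| chain_nil I of is_ideal I : chain I I 0
| chain_cons I K J n of is_ideal I & I `<` K & chain K J n : chain I J n.+1.

Lemma chain_ideal I J n : chain I J n -> [/\ is_ideal I, is_ideal J & I `<=` J].
Proof.
elim=> {I J n} [I hI|I K J n hI [IK _] _ [hK hJ KJ]]; first by split.
by split=> //; apply: subset_trans KJ.
Qed.

Lemma quot_lengthE I J : quot_length I J = supremum 0%N [set n | chain I J n].
Proof.
rewrite /quot_length; congr supremum; apply/seteqP; split=> n /=.
- elim: n I => [|n IH] I [L [L0 Ln idL ltL]].
    by rewrite -L0 -Ln; apply: chain_nil; apply: idL.
  apply: (@chain_cons _ (L 1%N)).
  + by rewrite -L0; apply: idL.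
  + by rewrite -L0; apply: ltL.
  + by apply: IH; exists (fun i => L i.+1); split=> // i ?; [apply: idL|apply: ltL].
- elim=> {I J n} [I hI|I K J n hI IK _ [L [L0 Ln idL ltL]]].
    by exists (fun=> I); split.
  exists (fun i => if i is i'.+1 then L i' else I); split=> //.
  + by case=> // i; apply: idL.
  + by case=> [_|i]; [rewrite L0|apply: ltL].
Qed.

(** Boundedness is recorded apart from [quot_length], whose default value 0 for unbounded chains
    carries no information. *)
Definition finlen I J :=
  [/\ is_ideal I, is_ideal J, I `<=` J & exists n, forall k, chain I J k -> (k <= n)%N].

Lemma ex_chain I J : is_ideal I -> is_ideal J -> I `<=` J -> exists k, chain I J k.
Proof.
move=> hI hJ IJ; have [JI|JI] := pselect (J `<=` I).
  by exists 0%N; have -> : J = I by [apply/seteqP]; apply: chain_nil.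
by exists 1%N; apply: (chain_cons hI (K := J)) => //; apply: chain_nil.
Qed.

Lemma finlen_spec I J : finlen I J -> chain I J (quot_length I J) /\
  forall k, chain I J k -> (k <= quot_length I J)%N.
Proof.
move=> [hI hJ IJ [n nP]]; rewrite quot_lengthE; set S := [set k | _].
have exS : exists k, `[< S k >].
  by have [k hk] := ex_chain hI hJ IJ; exists k; apply/asboolP.
have bS k : `[< S k >] -> (k <= n)%N by move/asboolP/nP.
have [M /asboolP SM maxM] := ex_maxnP exS bS.
suff -> : supremum 0%N S = M.
  by split=> // k Sk; apply: maxM; apply/asboolP.
have supM : supremums S M.
  split; first by move=> k Sk; apply: maxM; apply/asboolP.
  by move=> k /(_ M SM).
apply/eqP; rewrite eq_le; apply/andP; split.
- rewrite /supremum; case: ifPn => // _; case: xgetP => [y _ [_ +]|/(_ M)//].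
  by apply=> k Sk; apply: maxM; apply/asboolP.
- by apply: ge_supremum_Nmem => //; exists M.
Qed.

Lemma finlen_chain I J : finlen I J -> chain I J (quot_length I J).
Proof. by case/finlen_spec. Qed.

Lemma chain_le_len I J k : finlen I J -> chain I J k -> (k <= quot_length I J)%N.
Proof. by case/finlen_spec => _; apply. Qed.

Lemma len_le I J n : finlen I J -> (forall k, chain I J k -> (k <= n)%N) ->
  (quot_length I J <= n)%N.
Proof. by move=> /finlen_chain + h => /h. Qed.

Lemma chain_cat I K J p q : chain I K p -> chain K J q -> chain I J (p + q).
Proof.
elim=> {I K p} [//|I L K n hI IL _ IH] /IH; exact: chain_cons.
Qed.

(** Each term of the chain is intersected with [K] and added to [K]. By the modular law a strict
    step stays strict in at least one of the two images; it may do so in both, whence an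
    inequality. *)
Lemma chain_split I K J n : is_ideal K -> I `<=` K -> K `<=` J -> chain I J n ->
  exists p q, [/\ chain I K p, chain K J q & (n <= p + q)%N].
Proof.
move=> hK.
(* Later terms of the chain need not lie below [K], so the induction allows an arbitrary starting
   ideal. *)
suff H I' : chain I' J n -> K `<=` J -> exists p q,
    [/\ chain (I' `&` K) K p, chain (idsum I' K) J q & (n <= p + q)%N].
  move=> IK KJ c; have [hI hJ _] := chain_ideal c; have [p [q [cp cq npq]]] := H I c KJ.
  exists p, q; split=> //; first by rewrite (_ : I = I `&` K) //; apply/esym/setIidPl.
  rewrite (_ : K = idsum I K) //; apply/seteqP; split; first exact: idsum_subr.
  exact: idsum_lub.
elim=> {I I' J n} [I hI|I L J n hI [IL LI] cLJ IH] KJ.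
  exists 0%N, 0%N; rewrite (_ : I `&` K = K); last exact/setIidPr.
  rewrite (_ : idsum I K = I); first by split=> //; apply: chain_nil.
  by apply/seteqP; split; [exact: idsum_lub|exact: idsum_subl].
have [p [q [cp cq npq]]] := IH KJ; have [hL _ _] := chain_ideal cLJ.
have hIK := is_idealI hI hK; have hIpK := is_ideal_idsum hI hK.
have sub1 : I `&` K `<=` L `&` K by move=> x [/IL].
have sub2 : idsum I K `<=` idsum L K by move=> x [y /IL Iy Kx]; exists y.
have [e1|ne1] := pselect (L `&` K `<=` I `&` K); last first.
  exists p.+1; have [e2|ne2] := pselect (idsum L K `<=` idsum I K).
    exists q; split=> //; first by apply: chain_cons cp.
    by have -> : idsum I K = idsum L K by apply/seteqP.
  exists q.+1; split; [exact: chain_cons cp|exact: chain_cons cq|].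
  by rewrite addSn ltnS addnS leqW.
have [e2|ne2] := pselect (idsum L K `<=` idsum I K).
  exfalso; apply: LI => x Lx.
  have [y Iy Kxy] : idsum I K x by apply: e2; exact: idsum_subl.
  have [Ixy _] : (I `&` K) (x - y).
    by apply: e1; split=> //; apply: idealB => //; apply: IL.
  by rewrite -(subrK y x); apply: idealD.
exists p, q.+1; split; [|exact: chain_cons cq|by rewrite addnS ltnS].
by have -> : I `&` K = L `&` K by apply/seteqP.
Qed.

Lemma finlen_trans I K J : finlen I K -> finlen K J -> finlen I J.
Proof.
move=> f1 f2; have [hI hK IK _] := f1; have [_ hJ KJ _] := f2.
split=> //; first exact: subset_trans KJ.
exists (quot_length I K + quot_length K J)%N => k.
move=> /(chain_split hK IK KJ)[p [q [cp cq kpq]]]; apply: leq_trans kpq _.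
by apply: leq_add; exact: chain_le_len.
Qed.

Lemma finlen_sub I K L J : finlen I J -> is_ideal K -> is_ideal L ->
  I `<=` K -> K `<=` L -> L `<=` J -> finlen K L.
Proof.
move=> [hI hJ _ [n nP]] hK hL IK KL LJ; split=> //; exists n => k ck.
have [p cp] := ex_chain hI hK IK; have [q cq] := ex_chain hL hJ LJ.
apply: leq_trans (nP _ (chain_cat cp (chain_cat ck cq))).
by rewrite addnCA leq_addr.
Qed.

Lemma len_add I K J : finlen I J -> is_ideal K -> I `<=` K -> K `<=` J ->
  quot_length I J = (quot_length I K + quot_length K J)%N.
Proof.
move=> f hK IK KJ; have [hI hJ IJ _] := f.
have f1 : finlen I K by apply: finlen_sub f _ _ _ _ _.
have f2 : finlen K J by apply: finlen_sub f _ _ _ _ _.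
apply/eqP; rewrite eqn_leq; apply/andP; split.
  apply: len_le => // k /(chain_split hK IK KJ)[p [q [cp cq kpq]]].
  by apply: leq_trans kpq _; apply: leq_add; exact: chain_le_len.
by apply: chain_le_len => //; apply: chain_cat (finlen_chain f1) (finlen_chain f2).
Qed.

Lemma len_mono I K J : finlen I J -> is_ideal K -> I `<=` K -> K `<=` J ->
  (quot_length K J <= quot_length I J)%N.
Proof. by move=> f hK IK KJ; rewrite (len_add f hK IK KJ) leq_addl. Qed.

Lemma len_eq0 I J : finlen I J -> quot_length I J = 0%N -> I = J.
Proof.
move=> f l0; have [hI hJ IJ _] := f; apply/seteqP; split=> //.
apply: contrapT => JI.
have : chain I J 1 by apply: chain_cons (conj IJ JI) _ => //; apply: chain_nil.
by move=> /(chain_le_len f); rewrite l0.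
Qed.

Lemma len_inj I K J : finlen I J -> is_ideal K -> I `<=` K -> K `<=` J ->
  quot_length I J = quot_length K J -> I = K.
Proof.
move=> f hK IK KJ e; have [hI hJ IJ _] := f.
apply: len_eq0; first exact: finlen_sub f _ _ _ _ _.
by move: (len_add f hK IK KJ); rewrite e -[LHS]add0n => /addIn.
Qed.

Lemma finlen_refl I : is_ideal I -> finlen I I.
Proof.
move=> hI; split=> //; exists 0%N => k c; inversion c => //; subst.
by have [_ _ KI] := chain_ideal H1; case: H0 => _ [].
Qed.

Lemma len_refl I : is_ideal I -> quot_length I I = 0%N.
Proof.
move=> hI; have f := finlen_refl hI; have := len_add f hI (fun _ => id) (fun _ => id).
by lia.
Qed.

Lemma chain_map (phi : set A -> set A) I J n :
  (forall L, is_ideal L -> is_ideal (phi L)) ->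
  (forall L L', is_ideal L -> is_ideal L' -> I `<=` L -> L' `<=` J ->
     L `<` L' -> phi L `<` phi L') ->
  chain I J n -> chain (phi I) (phi J) n.
Proof.
move=> idphi ltphi c; elim: c ltphi => {I J n} [I hI|I K J n hI IK cKJ IH] ltphi.
  by apply: chain_nil; apply: idphi.
have [hK hJ KJ] := chain_ideal cKJ.
apply: (chain_cons (K := phi K)); first exact: idphi.
  exact: ltphi.
apply: IH => L L' hL hL' KL; apply: ltphi => //.
by apply: subset_trans KL; case: IK.
Qed.

Definition addmul J (x : A) M : set A := [set y | exists2 z, M z & J (y - x * z)].

Lemma is_ideal_addmul J x M : is_ideal J -> is_ideal M -> is_ideal (addmul J x M).
Proof.
move=> hJ hM; split.
- by exists 0; [exact: ideal0|rewrite mulr0 subr0; exact: ideal0].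
- move=> y z [y' My' Jy] [z' Mz' Jz]; exists (y' + z'); first exact: idealD.
  by rewrite mulrDr opprD addrACA; apply: idealD.
- move=> b y [y' My' Jy]; exists (b * y'); first exact: idealM.
  by rewrite mulrCA -mulrBr; apply: idealM.
Qed.

Lemma addmulT J x : addmul J x setT = addp J x.
Proof. by apply/seteqP; split=> y [c]; [move=> _|] => h; exists c. Qed.

Lemma addmul_sub J x M : is_ideal M -> J `<=` addmul J x M.
Proof. by move=> hM y Jy; exists 0; [exact: ideal0|rewrite mulr0 subr0]. Qed.

(* Multiplication by [x] identifies [M / (M :&: (J : x))] with [(J + x M) / J]. *)
Lemma chain_addmul J x M n : is_ideal J -> is_ideal M ->
  chain (M `&` colon1 J x) M n <-> chain J (addmul J x M) n.
Proof.
move=> hJ hM; have hC := is_ideal_colon1 x hJ; split.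
  move=> c; suff : chain (addmul J x (M `&` colon1 J x)) (addmul J x M) n.
    rewrite (_ : addmul J x (M `&` colon1 J x) = J) //; apply/seteqP; split.
      move=> y [z [_ Jz] Jyz]; rewrite -(subrK (x * z) y).
      by apply: idealD => //; rewrite mulrC.
    exact/addmul_sub/is_idealI.
  apply: (chain_map (phi := addmul J x)) c => [L|L L' hL hL' ML L'M [LL' L'L]].
    exact: is_ideal_addmul.
  split; first by move=> y [z /LL' Lz Jy]; exists z.
  move=> h; apply: L'L => y L'y.
  have [|z Lz Jyz] := h (x * y); first by exists y => //; rewrite subrr; exact: ideal0.
  rewrite -(subrK z y); apply: idealD => //; apply: ML; split.
    by apply: L'M; apply: idealB => //; apply: LL'.
  by rewrite /colon1 /= mulrBr.
move=> c; pose psi L := M `&` colon1 L x.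
suff : chain (psi J) (psi (addmul J x M)) n.
  rewrite (_ : psi (addmul J x M) = M) //; apply/seteqP; split; first by move=> y [].
  move=> y My; split=> //; exists y => //; rewrite subrr; exact: ideal0.
apply: (chain_map (phi := psi)) c => [L hL|L L' hL hL' JL L'M [LL' L'L]].
  exact/is_idealI/is_ideal_colon1.
split; first by move=> y [My /LL'].
move=> h; apply: L'L => y L'y; have [z Mz Jyz] := L'M _ L'y.
have L'xz : L' (x * z).
  by rewrite (_ : x * z = y - (y - x * z)); [apply: idealB => //; apply/LL'/JL|ring].
have [_ Lxz] : psi L z by apply: h.
by rewrite -(subrK (x * z) y); apply: idealD => //; apply: JL.
Qed.

Lemma len_addmul J x M : is_ideal J -> is_ideal M ->
  quot_length (M `&` colon1 J x) M = quot_length J (addmul J x M).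
Proof.
move=> hJ hM; rewrite !quot_lengthE; congr supremum.
by apply/seteqP; split=> n /(chain_addmul x n hJ hM).
Qed.

Lemma finlen_addmul J x M : is_ideal J -> is_ideal M ->
  finlen (M `&` colon1 J x) M <-> finlen J (addmul J x M).
Proof.
move=> hJ hM; have hC := is_idealI hM (is_ideal_colon1 x hJ).
have hJM := is_ideal_addmul x hJ hM.
split=> [[_ _ _ [n nP]]|[_ _ _ [n nP]]]; split=> //; try by exists n => k /chain_addmul-/(_ hJ hM)/nP.
  exact: addmul_sub.
Qed.

Lemma len_addp J x : is_ideal J ->
  quot_length J (addp J x) = quot_length (colon1 J x) setT.
Proof. by move=> hJ; rewrite -addmulT -len_addmul // setTI. Qed.

Lemma finlen_addp J x : is_ideal J ->
  finlen (colon1 J x) setT <-> finlen J (addp J x).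
Proof.
by move=> hJ; rewrite -addmulT -finlen_addmul // setTI.
Qed.

Lemma addmul1 I J : addmul J 1 I = idsum I J.
Proof.
by apply/seteqP; split=> x [y Iy Jy]; exists y; rewrite // ?mul1r // -(mul1r y).
Qed.

Lemma colon1_1 J : colon1 J 1 = J.
Proof. by apply/seteqP; split=> x; rewrite /colon1 /= mul1r. Qed.

(** Second isomorphism theorem, as the case [x = 1] of [len_addmul]. *)
Lemma len_idsum I J : is_ideal I -> is_ideal J ->
  quot_length (I `&` J) I = quot_length J (idsum I J).
Proof. by move=> hI hJ; rewrite -addmul1 -len_addmul // colon1_1. Qed.

End Length.

(** * Noetherian local rings: Nakayama's lemma and finite colength *)

Section NoetherianLocal.
Variables (A : comNzRingType) (m : set A).
Hypotheses (noeA : noetherian A) (locA : local_ring m).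
Implicit Types (I J K L P : set A) (s : seq A).

Lemma noeth_seqid I : is_ideal I -> exists s, I = seqid s.
Proof. by move=> /noeA[s ->]; exists s; rewrite seqidE. Qed.

Lemma noeth_stab (U : nat -> set A) : (forall n, is_ideal (U n)) ->
  (forall n, U n `<=` U n.+1) -> exists N, forall n, U n `<=` U N.
Proof.
move=> hU UU.
have U_le i j : (i <= j)%N -> U i `<=` U j.
  move=> /subnK <-; elim: (j - i)%N => [//|k IH] x /IH; rewrite addSn; exact: UU.
pose V := [set x | exists n, U n x].
have hV : is_ideal V.
  split.
  - by exists 0%N; exact: ideal0.
  - move=> x y [i Ux] [j Uy]; exists (maxn i j); apply: idealD => //.
      exact: U_le (leq_maxl i j) _ Ux.
    exact: U_le (leq_maxr i j) _ Uy.
  - by move=> a x [i Ux]; exists i; apply: idealM.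
have [s sV] := noeth_seqid hV.
suff [N sN] : exists N, forall a, a \in s -> U N a.
  exists N => n x Ux; have : V x by exists n.
  by rewrite sV; apply: seqid_sub.
have : forall a, a \in s -> V a by move=> a /seqid_mem; rewrite sV.
elim: s {sV} => [|a s IH] h; first by exists 0%N.
have [i Ua] := h a (mem_head _ _).
have [|j Uj] := IH; first by move=> b sb; apply: h; rewrite inE sb orbT.
exists (maxn i j) => b; rewrite inE => /predU1P[->|/Uj Ub].
  exact: U_le (leq_maxl i j) _ Ua.
exact: U_le (leq_maxr i j) _ Ub.
Qed.

Lemma noeth_max (C : set (set A)) J0 : (forall J, C J -> is_ideal J) -> C J0 ->
  exists J, [/\ C J, J0 `<=` J & forall J', C J' -> J `<=` J' -> J' `<=` J].
Proof.
move=> hC CJ0; apply: contrapT => noJ.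
have [F FP] : {F : set A -> set A & forall J, C J -> J0 `<=` J ->
    [/\ C (F J), J `<=` F J & ~ F J `<=` J]}.
  apply: (@choice _ _ (fun J J' => C J -> J0 `<=` J -> [/\ C J', J `<=` J' & ~ J' `<=` J])).
  move=> J; apply: contrapT => noJ'; apply: noJ; exists J.
  have [CJ J0J] : C J /\ J0 `<=` J.
    by split; apply: contrapT => h; apply: noJ'; exists J => // ?; case: h.
  split=> // J' CJ' JJ'; apply: contrapT => J'J; apply: noJ'; by exists J'.
have UC n : C (iter n F J0) /\ J0 `<=` iter n F J0.
  elim: n => [|n [Cn Jn]]; first by split.
  by have [Cn' le _] := FP _ Cn Jn; split=> //; apply: subset_trans le.
have [||N UN] := @noeth_stab (fun n => iter n F J0).
- by move=> n; apply: hC; case: (UC n).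
- by move=> n; have [Cn Jn] := UC n; case: (FP _ Cn Jn).
- by have [Cn Jn] := UC N; case: (FP _ Cn Jn) => _ _; apply; apply: (UN N.+1).
Qed.

Lemma max_ideal : is_ideal m. Proof. by case: locA => -[]. Qed.

Lemma max_proper : ~ m 1. Proof. by case: locA => -[]. Qed.

Lemma proper_sub_max J : is_ideal J -> ~ J 1 -> J `<=` m.
Proof.
move=> hJ J1.
have [|//|M [[hM M1] JM maxM]] := @noeth_max [set J | is_ideal J /\ ~ J 1] J.
  by move=> ? [].
rewrite -(proj2 locA M) //; split=> // L hL L1 ML.
by apply/seteqP; split=> //; apply: maxM.
Qed.

Lemma unit_notin x : ~ m x -> exists y, x * y = 1.
Proof.
move=> mx; pose J := addp [set 0] x.
have h0 : is_ideal [set (0 : A)] by rewrite -seqid_nil; exact: seqid_ideal.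
have hJ : is_ideal J by exact: is_ideal_addp.
have [[c /= /eqP]|J1] := pselect (J 1).
  by rewrite subr_eq0 => /eqP h; exists c.
by case: mx; apply: (proper_sub_max hJ J1); exact: addp_mem.
Qed.

Lemma unit_sub1 x : m x -> exists y, (1 - x) * y = 1.
Proof.
move=> mx; apply: unit_notin => m1x; apply: max_proper.
by rewrite -(subrK x 1); apply: idealD => //; exact: max_ideal.
Qed.

(** The first generator is eliminated, because 1 - z is a unit for z in [m]; the remaining
    generators then satisfy the same hypothesis. *)
Lemma nakayama I J : is_ideal I -> is_ideal J ->
  J `<=` idsum (ideal_mul m J) I -> J `<=` I.
Proof.
move=> hI /noeth_seqid[s ->].
elim: s => [|a s IH] h; first by rewrite seqid_nil => x ->; exact: ideal0.
have mseq : ideal_mul m (seqid (a :: s)) `<=` addmul (ideal_mul m (seqid s)) a m.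
  apply: mul_sub; first exact: is_ideal_addmul (mul_ideal _ _) max_ideal.
  move=> x y mx; rewrite seqid_cons => -[c sy]; exists (x * c).
    exact: idealMr max_ideal mx.
  by rewrite (_ : _ - _ = x * (y - a * c)); [apply: mul_mem|ring].
have ha : idsum (ideal_mul m (seqid s)) I a.
  have [|y /mseq[z mz sz] Iy] := h a; first by apply: seqid_mem; rewrite mem_head.
  have [u zu] := unit_sub1 mz.
  exists (u * (y - a * z)).
    exact: idealM (mul_ideal _ _) sz.
  rewrite (_ : _ - _ = u * (a - y)); first exact: idealM.
  by rewrite -[X in X - _](mulr1 a) -zu; ring.
have hs : seqid s `<=` I.
  apply: IH => x sx; have [|y /mseq[z mz sy] Iy] := h x.
    by rewrite seqid_cons; apply: addp_sub.
  have hsI := is_ideal_idsum (mul_ideal m (seqid s)) hI.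
  rewrite (_ : x = (x - y) + (y - a * z) + z * a); last by ring.
  apply: idealD => //; last exact: idealM.
  apply: idealD => //; last exact: idsum_subl.
  by apply: idsum_subr => //; exact: mul_ideal.
rewrite seqid_cons; apply: addp_lub => //.
suff : idsum (ideal_mul m (seqid s)) I `<=` I by apply.
apply: idsum_lub => //; apply: mul_sub => // x y _ /hs; exact: idealM.
Qed.

(** (I + aA)/I is cyclic and killed by [m]: an intermediate ideal larger than [I] contains some a c
    with c outside [m], so c is a unit and the ideal contains [a]. *)
Lemma chain_addp_le1 I a k : is_ideal I -> (forall t, m t -> I (t * a)) ->
  chain I (addp I a) k -> (k <= 1)%N.
Proof.
move=> hI mI c; inversion c as [|? K ? n ? [IK KI] cK]; subst => //.
have [hK _ KaI] := chain_ideal cK.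
suff aIK : addp I a `<=` K.
  have e : K = addp I a by apply/seteqP.
  by move: cK; rewrite e; have := finlen_refl (is_ideal_addp a hI);
    move=> /chain_le_len h /h; rewrite len_refl //; exact: is_ideal_addp.
apply: addp_lub => //; apply: contrapT => Ka; apply: KI => x Kx.
have [c' Ixc] := KaI _ Kx; rewrite -(subrK (a * c') x); apply: idealD => //.
rewrite mulrC; apply: mI; apply: contrapT => /unit_notin[u cu]; apply: Ka.
have : K (a * c') by rewrite -(subKr x (a * c')); apply: idealB => //; apply: IK.
by move=> /(idealM u hK); rewrite mulrCA (mulrC u) cu mulr1.
Qed.

Lemma finlen_addp_max I a : is_ideal I -> (forall t, m t -> I (t * a)) ->
  finlen I (addp I a) /\ (quot_length I (addp I a) <= 1)%N.
Proof.
move=> hI mI; suff f : finlen I (addp I a).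
  by split=> //; apply: len_le => // k; exact: chain_addp_le1.
split=> //; [exact: is_ideal_addp|exact: addp_sub|].
by exists 1%N => k; exact: chain_addp_le1.
Qed.

(** Adjoining the generators of [J] to m J one at a time adds pieces of length at most one. *)
Lemma finlen_mul J : is_ideal J -> finlen (ideal_mul m J) J.
Proof.
move=> hJ; have [s Js] := noeth_seqid hJ; have hm := mul_ideal m J.
suff f : finlen (ideal_mul m J) (idsum (ideal_mul m J) (seqid s)).
  suff JE : idsum (ideal_mul m J) (seqid s) = J by rewrite JE in f.
  apply/seteqP; split; last by rewrite -Js; exact: idsum_subr.
  by apply: idsum_lub; rewrite -?Js //; apply: mul_sub => // x y _; exact: idealM.
have : forall a, a \in s -> J a by move=> a /seqid_mem; rewrite Js.
elim: s {Js} => [|a s IH] sJ.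
  rewrite (_ : idsum _ _ = ideal_mul m J); first exact: finlen_refl.
  apply/seteqP; split; last exact: idsum_subl (seqid_ideal _).
  by apply: idsum_lub => //; rewrite seqid_nil => x ->; exact: ideal0.
have {}IH := IH (fun b sb => sJ b (@mem_behead _ (a :: s) b sb)).
apply: finlen_trans IH _; set K := idsum _ _.
have hK : is_ideal K by exact/is_ideal_idsum/seqid_ideal.
rewrite (_ : idsum _ _ = addp K a).
  apply: (proj1 (finlen_addp_max hK _)) => t mt; apply: idsum_subl; first exact: seqid_ideal.
  by apply: mul_mem => //; apply: sJ; rewrite mem_head.
apply/seteqP; split=> x.
  move=> [y my]; rewrite seqid_cons => -[c sc]; exists c; exists y => //.
  by rewrite (_ : _ - _ = x - y - a * c) //; ring.
move=> [c [y my sc]]; exists y => //; rewrite seqid_cons; exists c.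
by rewrite (_ : _ - _ = x - a * c - y) //; ring.
Qed.

Lemma finlen_pow n : finlen (powid m n) setT.
Proof.
elim: n => [|n IH]; first exact/finlen_refl/is_ideal_setT.
apply: finlen_trans IH; rewrite powidS; apply: finlen_mul; exact: powid_ideal.
Qed.

Definition primary J := exists k, powid m k `<=` J.

Lemma finlen_primary J : is_ideal J -> primary J -> finlen J setT.
Proof. by move=> hJ [k kJ]; apply: finlen_sub (finlen_pow k) _ _ _ _ _. Qed.

Lemma primaryS J J' : J `<=` J' -> primary J -> primary J'.
Proof. by move=> JJ' [k kJ]; exists k; apply: subset_trans JJ'. Qed.

(** The exponent [k * n] comes from (P + aA)^n <= P + a^n A. *)
Lemma primary_addp_exp P a n : is_ideal P -> primary (addp P a) -> primary (addp P (a ^+ n)).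
Proof.
move=> hP [k kP]; exists (k * n)%N; elim: n => [|n IH].
  by move=> x _; exists x; rewrite expr0 mul1r subrr; exact: ideal0.
rewrite mulnS => x /powid_addn; move: x; apply: mul_sub; first exact: is_ideal_addp.
move=> x y /kP[c Px] /IH[d Py]; exists (c * d).
rewrite exprS (_ : _ - _ = (x - a * c) * y + a * c * (y - a ^+ n * d)); last by ring.
by apply: idealD => //; [apply: idealMr|apply: idealM].
Qed.

Lemma primary_mem_exp P x : primary P -> m x -> exists n, P (x ^+ n).
Proof. by move=> [k kP] mx; exists k; apply: kP; exact: powid_exp. Qed.

End NoetherianLocal.

(** * Antitone functions on exponent vectors and their stabilization *)

Definition antitone d (f : seq nat -> nat) :=
  forall a b, size a = d -> all2 leq a b -> (f b <= f a)%N.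

Lemma antitone_cons d f i : antitone d.+1 f -> antitone d (fun a => f (i :: a)).
Proof. by move=> hf a b sa ab; apply: hf; rewrite /= ?sa // leqnn. Qed.

Lemma all2_leq_refl a : all2 leq a a.
Proof. by elim: a => //= i a ->; rewrite leqnn. Qed.

Lemma nat_stab (u : nat -> nat) : (forall i j, (i <= j)%N -> (u j <= u i)%N) ->
  exists N, forall i, (N <= i)%N -> u i = u N.
Proof.
move=> hu.
have exP : exists v, `[< exists i, u i = v >] by exists (u 0%N); apply/asboolP; exists 0%N.
have [v /asboolP[N uN] minv] := ex_minnP exP.
exists N => i Ni; apply/eqP; rewrite eqn_leq hu //= uN; apply: minv.
by apply/asboolP; exists i.
Qed.

(* A form of Dickson's lemma. *)
Lemma antitone_stab d (g : nat -> seq nat -> nat) : (forall i, antitone d (g i)) ->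
  (forall i j a, size a = d -> (i <= j)%N -> (g j a <= g i a)%N) ->
  exists N, forall i a, (N <= i)%N -> size a = d -> g i a = g N a.
Proof.
elim: d g => [|d IH] g hg gg.
  have [|N hN] := @nat_stab (fun i => g i [::]); first by move=> i j; apply: gg.
  by exists N => i a Ni /size0nil->; apply: hN.
(* The diagonal, where index and first exponent agree, is again decreasing. Past its stabilization
   index [N0] it controls every first exponent at least [N0]; the finitely many smaller ones are
   treated separately. *)
have [||N0 hN0] := IH (fun i a => g i (i :: a)).
- by move=> i; apply: antitone_cons.
- move=> i j a sa ij; apply: (@leq_trans (g j (i :: a))).
    by apply: (hg j); rewrite /= ?sa // ij all2_leq_refl.
  by apply: gg; rewrite /= ?sa.
have [N1 [N01 hN1]] : exists N1, (N0 <= N1)%N /\ forall j, (j < N0)%N ->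
    forall i a, (N1 <= i)%N -> size a = d -> g i (j :: a) = g N1 (j :: a).
  have : (N0 <= N0)%N by [].
  elim: {1 4}N0 => [|k IHk] kN0; first by exists N0.
  have [N1 [N01 hN1]] := IHk (ltnW kN0).
  have [||N2 hN2] := IH (fun i a => g i (k :: a)).
  - by move=> i; apply: antitone_cons.
  - by move=> i j a sa ij; apply: gg; rewrite /= ?sa.
  exists (maxn N1 N2); split; first by rewrite leq_max N01.
  move=> j; rewrite ltnS leq_eqVlt => /predU1P[->|jk] i a; rewrite geq_max => /andP[N1i N2i] sa.
    by rewrite (hN2 i) // (hN2 (maxn N1 N2)) // leq_maxr.
  by rewrite (hN1 j jk i) // (hN1 j jk (maxn N1 N2)) // leq_maxl.
exists N1 => i [//|j a] Ni [sa].
have [jN0|N0j] := ltnP j N0; first exact: hN1.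
(* The value is squeezed between diagonal values: from above by the one at [N0], from below by the
   one at [maxn i' j]. *)
have key i' : (N0 <= i')%N -> g i' (j :: a) = g N0 (N0 :: a).
  move=> N0i; apply/eqP; rewrite eqn_leq; apply/andP; split.
    apply: (@leq_trans (g N0 (j :: a))); first by apply: gg; rewrite /= ?sa.
    by apply: hg; rewrite /= ?sa // N0j all2_leq_refl.
  rewrite -(hN0 (maxn i' j)) //; last by rewrite leq_max N0i.
  apply: (@leq_trans (g (maxn i' j) (j :: a))).
    by apply: hg; rewrite /= ?sa // leq_maxr all2_leq_refl.
  by apply: gg; rewrite /= ?sa // leq_maxl.
by rewrite !key // (leq_trans N01).
Qed.

Fixpoint simplex d N : seq (seq nat) :=
  if d is d'.+1 then [seq i :: a | i <- iota 0 N, a <- simplex d' (N - i)%N]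
  else nseq (0 < N)%N [::].

Lemma mem_simplex d N a : (a \in simplex d N) = (size a == d) && (sumn a < N)%N.
Proof.
elim: d N a => [|d IH] N a /=.
  by rewrite mem_nseq lt0b; case: a => [|i a]; rewrite /= ?andbT ?andbF.
apply/allpairsPdep/idP => [[i [b [iN bS ->]]]|].
  move: iN bS; rewrite mem_iota add0n /= IH eqSS => iN /andP[-> bS] /=.
  by lia.
case: a => [|i a] //=; rewrite eqSS => /andP[sa iaN]; exists i, a; split=> //.
  by rewrite mem_iota; lia.
by rewrite IH sa; lia.
Qed.

Lemma simplex_uniq d N : uniq (simplex d N).
Proof.
elim: d N => [|d IH] N /=; first by case: N.
apply: allpairs_uniq_dep; first exact: iota_uniq.
  by move=> i _; exact: IH.
by move=> [i a] [j b] _ _ /= [-> ->].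
Qed.

(** * Integer sequences with an eventually constant higher difference *)

Definition delta (s : nat -> int) n : int := s n.+1 - s n.

(* Eventually, [s] agrees with a polynomial of degree at most [d] in which [N ^ d] has coefficient [L / d`!]. *)
Definition eventual_degree d (L : int) (s : nat -> int) :=
  exists N0, forall N, (N0 <= N)%N -> iter d delta s N = L.

Lemma eventual_degree_ext d L s s' N0 : (forall N, (N0 <= N)%N -> s N = s' N) ->
  eventual_degree d L s -> eventual_degree d L s'.
Proof.
move=> ss' [N1 h]; exists (maxn N0 N1) => N; rewrite geq_max => /andP[N0N N1N].
rewrite -(h N N1N); elim: d N N0N {N1N h} => [|d IH] N N0N /=.
  by rewrite ss'.
by rewrite /delta !IH // leqW.
Qed.

Lemma eventual_degreeS d L s : eventual_degree d.+1 L s <-> eventual_degree d L (delta s).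
Proof. by split=> -[N0 h]; exists N0 => N; [rewrite -iterSr|rewrite iterSr]; apply: h. Qed.

Lemma eventual_degree_lower d L s : eventual_degree d L s -> eventual_degree d.+1 0 s.
Proof.
by move=> [N0 h]; exists N0 => N N0N; rewrite iterS /delta !h ?subrr // leqW.
Qed.

Lemma eventual_degreeD d L L' s s' : eventual_degree d L s -> eventual_degree d L' s' ->
  eventual_degree d (L + L') (fun n => s n + s' n).
Proof.
elim: d s s' => [|d IH] s s'.
  move=> [N0 h] [N1 h']; exists (maxn N0 N1) => N; rewrite geq_max => /andP[? ?].
  by rewrite /= -(h N) // -(h' N).
rewrite !eventual_degreeS => h h'; have := IH _ _ h h'.
by apply: (@eventual_degree_ext _ _ _ _ 0%N) => N _; rewrite /delta; ring.
Qed.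

Lemma eventual_degree0 d : eventual_degree d 0 (fun=> 0).
Proof.
elim: d => [|d IH]; first by exists 0%N.
by rewrite eventual_degreeS; apply: (@eventual_degree_ext _ _ _ _ 0%N) IH => N _; rewrite /delta subrr.
Qed.

Lemma eventual_degree_sum d n (L : nat -> int) (s : nat -> nat -> int) :
  (forall i, (i < n)%N -> eventual_degree d (L i) (s i)) ->
  eventual_degree d (\sum_(i < n) L i) (fun N => \sum_(i < n) s i N).
Proof.
elim: n => [|n IH] h.
  rewrite big_ord0; apply: (@eventual_degree_ext _ _ _ _ 0%N) (eventual_degree0 d) => N _.
  by rewrite big_ord0.
rewrite big_ord_recr /=.
have := eventual_degreeD (IH (fun i hi => h i (ltnW hi))) (h n (ltnSn n)).
by apply: (@eventual_degree_ext _ _ _ _ 0%N) => N _; rewrite big_ord_recr.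
Qed.

Lemma eventual_degree_addn d L s k : eventual_degree d L s ->
  eventual_degree d L (fun n => s (n + k)%N).
Proof.
elim: d s => [|d IH] s.
  by move=> [N0 h]; exists N0 => N N0N; apply: h; apply: leq_trans N0N (leq_addr _ _).
by rewrite !eventual_degreeS => /IH; apply: (@eventual_degree_ext _ _ _ _ 0%N).
Qed.

Lemma eventual_degree_subn d L s k : eventual_degree d L s ->
  eventual_degree d L (fun n => s (n - k)%N).
Proof.
elim: d s => [|d IH] s.
  by move=> [N0 h]; exists (N0 + k)%N => N N0N; apply: h; lia.
rewrite !eventual_degreeS => /IH; apply: (@eventual_degree_ext _ _ _ _ k) => N kN.
by rewrite /delta subSn.
Qed.

Lemma delta_telescope s a n :
  s (a + n)%N - s a = \sum_(r < n) delta s (a + r)%N.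
Proof.
elim: n => [|n IH]; first by rewrite big_ord0 addn0 subrr.
by rewrite big_ord_recr /= -IH /delta addnS; ring.
Qed.

(** By telescoping, a difference of [s (n * N)] is a sum of [n] values of [delta s] along
    progressions of step [n], each contributing [L *+ n ^ d] by induction. *)
Lemma eventual_degree_mul d L s n : (0 < n)%N -> eventual_degree d L s ->
  eventual_degree d (L *+ n ^ d) (fun N => s (n * N)%N).
Proof.
move=> n0; elim: d s => [|d IH] s.
  by move=> [N0 h]; exists N0 => N N0N; rewrite -(h (n * N)%N) //; nia.
rewrite !eventual_degreeS => h.
have := @eventual_degree_sum d n (fun=> L *+ n ^ d) (fun r N => delta s (n * N + r)%N)
  (fun r _ => IH _ (eventual_degree_addn r h)).
rewrite sumr_const card_ord -mulrnA -expnSr.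
apply: (@eventual_degree_ext _ _ _ _ 0%N) => N _.
by rewrite -delta_telescope /delta mulnS addnC.
Qed.

(** By induction the differences are eventually negative; being integers, they are at most -1, so
    the sequence falls below zero. *)
Lemma eventual_degree_lt0 d L s : L < 0 -> eventual_degree d L s ->
  exists N0, forall N, (N0 <= N)%N -> s N < 0.
Proof.
move=> L0; elim: d s => [|d IH] s; first by move=> [N0 h]; exists N0 => N /h /= ->.
rewrite eventual_degreeS => /IH[N0 h].
have h' k : s (N0 + k)%N <= s N0 - k%:Z.
  elim: k => [|k IHk]; first by rewrite addn0 subr0.
  by have := h (N0 + k)%N (leq_addr _ _); rewrite /delta addnS; lia.
exists (N0 + `|s N0|.+1)%N => N hN; have := h' (N - N0)%N.
by rewrite subnKC; lia.
Qed.

Lemma eventual_degreeN d L s : eventual_degree d L s -> eventual_degree d (- L) (fun n => - s n).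
Proof.
elim: d s => [|d IH] s; first by move=> [N0 h]; exists N0 => N /h /= ->.
rewrite !eventual_degreeS => /IH; apply: (@eventual_degree_ext _ _ _ _ 0%N) => N _.
by rewrite /delta; ring.
Qed.

Lemma eventual_degree_le d L L' s s' N0 : eventual_degree d L s -> eventual_degree d L' s' ->
  (forall N, (N0 <= N)%N -> s N <= s' N) -> L <= L'.
Proof.
move=> h h' ss'; rewrite leNgt; apply/negP => LL'.
have [|N1 h1] := eventual_degree_lt0 _ (eventual_degreeD h' (eventual_degreeN h)).
  by rewrite subr_lt0.
by have := h1 (maxn N0 N1) (leq_maxr _ _); have := ss' (maxn N0 N1) (leq_maxl _ _); lia.
Qed.

(** * Sums of antitone functions over simplices *)

Definition is_minimum d (f : seq nat -> nat) L :=
  (exists2 a, size a = d & f a = L) /\ forall a, size a = d -> (L <= f a)%N.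

Definition simplex_sum d (f : seq nat -> nat) N := (\sum_(a <- simplex d N) f a)%N.

Lemma simplex_sumS d f N : simplex_sum d.+1 f N =
  (\sum_(i < N) simplex_sum d (fun a => f ((i : nat) :: a)) (N - i))%N.
Proof.
by rewrite /simplex_sum /= big_allpairs_dep -{1}(subn0 N) big_mkord.
Qed.

(** The simplex is sliced by the first exponent. From some [i0] on all slices carry the same
    function, which attains the minimum; the finitely many earlier slices have lower degree and do
    not affect the top difference. *)
Theorem simplex_sum_degree d f : antitone d f -> exists L, is_minimum d f L /\
  eventual_degree d L%:Z (fun N => (simplex_sum d f N)%:Z).
Proof.
elim: d f => [|d IH] f hf.
  exists (f [::]); split; first by split; [exists [::]|move=> a /size0nil->].
  by exists 1%N => -[//|N] _; rewrite /= /simplex_sum big_seq1.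
have [||i0 hi0] := @antitone_stab d (fun i a => f (i :: a)).
- by move=> i; apply: antitone_cons.
- by move=> i j a sa ij; apply: hf; rewrite /= ?sa // ij all2_leq_refl.
have [L [[[a0 sa0 fa0] minL] degL]] := IH _ (antitone_cons i0 hf).
exists L; split.
  split; first by exists (i0 :: a0); rewrite //= sa0.
  move=> [//|i a] [sa]; apply: leq_trans (minL a sa) _.
  rewrite -(hi0 (maxn i0 i)) ?leq_maxl //.
  by apply: hf; rewrite /= ?sa // leq_maxr all2_leq_refl.
have deg1 : eventual_degree d.+1 0
    (fun N => \sum_(i < i0) (simplex_sum d (fun a => f ((i : nat) :: a)) (N - i))%:Z).
  have := @eventual_degree_sum d.+1 i0 (fun=> 0)
    (fun i N => (simplex_sum d (fun a => f (i :: a)) (N - i))%:Z).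
  rewrite big1 //; apply=> i _.
  have [Li [_ degLi]] := IH _ (antitone_cons i hf).
  exact: (eventual_degree_lower (eventual_degree_subn i degLi)).
(* The slices from [i0] on have sizes N - i0, ..., 1, which in reverse order are the numbers
   [j.+1]. *)
have deg2 : eventual_degree d.+1 L%:Z
    (fun N => \sum_(j < N - i0) (simplex_sum d (fun a => f (i0 :: a)) j.+1)%:Z).
  rewrite eventual_degreeS.
  have := eventual_degree_subn i0 (eventual_degree_addn 1 degL).
  apply: (@eventual_degree_ext _ _ _ _ i0) => N i0N; rewrite /delta subSn //.
  by rewrite big_ord_recr /= addrC addrK addn1.
have := eventual_degreeD deg1 deg2; rewrite add0r.
apply: (@eventual_degree_ext _ _ _ _ i0) => N i0N.
pose F (i : nat) : int := (simplex_sum d (fun a => f (i :: a)) (N - i))%:Z.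
rewrite simplex_sumS -[RHS]natz natr_sum (_ : \sum_(i < N) _ = \sum_(i < i0 + (N - i0)) F i).
  rewrite big_split_ord /=; congr (_ + _).
  rewrite [RHS](reindex_inj rev_ord_inj) /=; apply: eq_bigr => j _; rewrite /F; congr (Posz _).
  rewrite (_ : (N - (i0 + _))%N = j.+1); last by have := ltn_ord j; lia.
  rewrite /simplex_sum [LHS]big_seq [RHS]big_seq; apply: eq_bigr => a.
  rewrite mem_simplex => /andP[/eqP sa _].
  by rewrite (hi0 (i0 + _)%N) // leq_addr.
by rewrite subnKC //; apply: eq_bigr => i _; rewrite natz.
Qed.

Lemma eventual_degree_leq d (L L' : nat) (s s' : nat -> nat) N0 :
  eventual_degree d L%:Z (fun N => (s N)%:Z) ->
  eventual_degree d L'%:Z (fun N => (s' N)%:Z) ->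
  (forall N, (N0 <= N)%N -> (s N <= s' N)%N) -> (L <= L')%N.
Proof.
move=> h h' ss'; have := eventual_degree_le (N0 := N0) h h'.
by rewrite lez_nat; apply=> N /ss'; rewrite lez_nat.
Qed.

(* The Hilbert function of [(x ^ n, ys)] is dominated by the simplex sum of this function. *)
Definition dilate_head n (f : seq nat -> nat) a :=
  (\sum_(r < n) f ((n * head 0 a + r) :: behead a))%N.

Lemma antitone_dilate_head d n f : antitone d.+1 f -> antitone d.+1 (dilate_head n f).
Proof.
move=> hf [|i a] [|j b] //= sa /andP[ij ab]; rewrite /dilate_head /=.
apply: leq_sum => r _; apply: hf => //=; rewrite ab andbT.
by rewrite leq_add2r leq_mul2l ij orbT.
Qed.

(** Above a minimizer an antitone function stays at its minimum, so there all [n] summands equal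
    [L]. *)
Lemma is_minimum_dilate_head d n f L : (0 < n)%N -> antitone d.+1 f ->
  is_minimum d.+1 f L -> is_minimum d.+1 (dilate_head n f) (n * L).
Proof.
move=> n0 hf [[a sa fa] minL]; split; last first.
  move=> [//|i b] [sb]; rewrite /dilate_head (_ : n * L = \sum_(r < n) L)%N.
    by apply: leq_sum => r _; apply: minL; rewrite /= sb.
  by rewrite sum_nat_const card_ord.
exists a => //; case: a sa fa => //= i a [sa] fa.
rewrite /dilate_head /= (eq_bigr (fun=> L)) ?sum_nat_const ?card_ord // => r _.
apply/eqP; rewrite eqn_leq minL /= ?sa // andbT -fa.
by apply: hf; rewrite /= ?sa // all2_leq_refl andbT; nia.
Qed.

Lemma is_minimum_unique d f L L' : is_minimum d f L -> is_minimum d f L' -> L = L'.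
Proof.
move=> [[a sa <-] h] [[a' sa' <-] h']; apply/eqP; rewrite eqn_leq.
by rewrite h // h'.
Qed.

(** * Newton expansion and comparison with rational polynomials *)

(** The coefficients are those of [delta s] shifted by one place, preceded by [s N0]; Pascal's rule
    carries the induction on [k]. *)
Lemma newton_binomial d L s N0 : (forall N, (N0 <= N)%N -> iter d delta s N = L) ->
  exists c : nat -> int, c d = L /\
    forall k, s (N0 + k)%N = \sum_(j < d.+1) c j * 'C(k, j)%:Z.
Proof.
elim: d s => [|d IH] s h.
  exists (fun=> L); split=> // k.
  by rewrite big_ord1 bin0 mulr1 -(h (N0 + k)%N) ?leq_addr.
have [N N0N|c [cd cE]] := IH (delta s); first by rewrite -iterSr h.
exists (fun j => if j is j'.+1 then c j' else s N0); split=> // k.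
rewrite big_ord_recl /= bin0 mulr1.
elim: k => [|k IHk].
  by rewrite addn0 big1 ?addr0 // => i _; rewrite bin0n mulr0.
have -> : s (N0 + k.+1)%N = s (N0 + k)%N + delta s (N0 + k)%N.
  by rewrite /delta addnS; ring.
rewrite IHk cE -addrA -big_split /=; congr (_ + _); apply: eq_bigr => i _.
by rewrite /bump /= !add1n binS PoszD mulrDr.
Qed.

(** The binomial coefficient of X - [N0] over [k], as a polynomial in X. *)
Definition binpoly N0 k : {poly rat} :=
  (k`!%:R)^-1 *: \prod_(i < k) ('X - (N0 + i)%:R%:P).

Lemma binpoly_eval N0 k n : (binpoly N0 k).[(N0 + n)%:R] = 'C(n, k)%:R.
Proof.
rewrite /binpoly hornerZ horner_prod.
have -> : \prod_(i < k) ('X - (N0 + i)%:R%:P).[(N0 + n)%:R] = (n ^_ k)%:R :> rat.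
  elim: k => [|k IH]; first by rewrite big_ord0.
  rewrite big_ord_recr /= IH hornerXsubC ffactnSr natrM.
  have [kn|nk] := leqP k n; last by rewrite ffact_small // !mul0r.
  by congr (_ * _); rewrite natrB // !natrD; ring.
by rewrite -bin_ffact natrM mulrC mulfK // pnatr_eq0 -lt0n fact_gt0.
Qed.

Lemma size_binpoly N0 k : size (binpoly N0 k) = k.+1.
Proof.
rewrite size_scale ?invr_eq0 ?pnatr_eq0 -?lt0n ?fact_gt0 //.
by rewrite size_prod_XsubC [index_enum _]unlock -enumT size_enum_ord.
Qed.

Lemma binpoly_lead N0 k : (binpoly N0 k)`_k = (k`!%:R)^-1.
Proof.
have := lead_coefE (binpoly N0 k); rewrite size_binpoly /= => <-.
by rewrite lead_coefZ (monicP (monic_prod_XsubC _ _ _)) mulr1.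
Qed.

Lemma eventual_degree_poly d L s : eventual_degree d L s ->
  exists p : {poly rat}, [/\ (size p <= d.+1)%N, p`_d * d`!%:R = L%:~R
    & exists N0, forall N, (N0 <= N)%N -> p.[N%:R] = (s N)%:~R].
Proof.
move=> [N0 h]; have [c [cd cE]] := newton_binomial h.
exists (\sum_(j < d.+1) (c j)%:~R *: binpoly N0 j); split.
- apply: (leq_trans (size_sum _ _ _)); apply/bigmax_leqP => j _.
  by apply: (leq_trans (size_scale_leq _ _)); rewrite size_binpoly.
- rewrite big_ord_recr coefD /= coefZ binpoly_lead coef_sum big1 ?add0r.
    by rewrite cd mulfVK // pnatr_eq0 -lt0n fact_gt0.
  by move=> j _; rewrite coefZ nth_default ?mulr0 // size_binpoly.
- exists N0 => N N0N; rewrite -(subnKC N0N) cE horner_sum rmorph_sum /=.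
  by apply: eq_bigr => j _; rewrite hornerZ binpoly_eval rmorphM.
Qed.

Lemma lead_coef_ge0 (p : {poly rat}) N0 :
  (forall N, (N0 <= N)%N -> 0 <= p.[N%:R]) -> 0 <= lead_coef p.
Proof.
move=> h; rewrite leNgt; apply/negP => lp.
have [|x hx] := @poly_pinfty_gt_lc _ (- p); first by rewrite lead_coefN oppr_gt0.
pose N := maxn N0 (Num.bound `|x|).
have xN : x <= N%:R.
  apply: le_trans (ler_norm x) (ltW (lt_le_trans (archi_boundP (normr_ge0 x)) _)).
  by rewrite ler_nat leq_maxr.
have := h N (leq_maxl _ _); have := hx _ xN.
rewrite hornerN lead_coefN => h1 h2; move: lp; rewrite -oppr_gt0 => lp.
by have := lt_le_trans lp h1; rewrite oppr_gt0 ltNge h2.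
Qed.

(** The degree of [p] is not known beforehand. If it exceeded [d], then [q - p] would have leading
    coefficient opposite to that of [p], while both are nonnegative. *)
Lemma poly_le_eventual_degree d (p : {poly rat}) L (s : nat -> int) N0 :
  eventual_degree d L s ->
  (forall N, (N0 <= N)%N -> 0 <= p.[N%:R] <= (s N)%:~R) -> p`_d * d`!%:R <= L%:~R.
Proof.
move=> /eventual_degree_poly[q [sq qd [N1 qs]]] hp.
rewrite -qd ler_pM2r ?ltr0n ?fact_gt0 // -subr_ge0 -coefB.
have r0 : 0 <= lead_coef (q - p).
  apply: (@lead_coef_ge0 _ (maxn N0 N1)) => N; rewrite geq_max => /andP[N0N N1N].
  by rewrite hornerD hornerN subr_ge0 qs //; case/andP: (hp N N0N).
have p0 : 0 <= lead_coef p by apply: (@lead_coef_ge0 _ N0) => N /hp/andP[].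
have sp : (size p <= d.+1)%N.
  rewrite leqNgt; apply/negP => dp; move: r0.
  rewrite addrC lead_coefDl ?size_polyN ?(leq_ltn_trans sq) // lead_coefN oppr_ge0 => p0'.
  have : lead_coef p == 0 by rewrite eq_le p0 p0'.
  by rewrite lead_coef_eq0 => /eqP pE; rewrite pE size_poly0 in dp.
have sr : (size (q - p)%R <= d.+1)%N.
  by apply: (leq_trans (size_polyD _ _)); rewrite size_polyN geq_max sq.
move: sr; rewrite leq_eqVlt => /predU1P[sr|sr]; last by rewrite nth_default.
by move: r0; rewrite lead_coefE sr.
Qed.

(** * Exponent vectors and their degree-lexicographic order *)

Fixpoint addm (a b : seq nat) : seq nat :=
  match a, b with i :: a', j :: b' => (i + j)%N :: addm a' b' | _, _ => [::] end.

Lemma size_addm a b : size a = size b -> size (addm a b) = size a.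
Proof. by elim: a b => [|i a IH] [|j b] //= [/IH->]. Qed.

Lemma sumn_addm a b : size a = size b -> sumn (addm a b) = (sumn a + sumn b)%N.
Proof. by elim: a b => [|i a IH] [|j b] //= [/IH->]; lia. Qed.

Lemma addm_leq a b : all2 leq a b -> exists2 c, size c = size a & b = addm a c.
Proof.
elim: a b => [|i a IH] [|j b] //=; first by exists [::].
move=> /andP[ij /IH[c sc ->]]; exists ((j - i)%N :: c); rewrite /= ?sc //.
by rewrite subnKC.
Qed.

Fixpoint lexlt (a b : seq nat) : bool :=
  match a, b with
  | i :: a', j :: b' => (i < j)%N || (i == j) && lexlt a' b'
  | [::], _ :: _ => true
  | _, [::] => false
  end.

Lemma lexltnn a : lexlt a a = false.
Proof. by elim: a => //= i a ->; rewrite ltnn eqxx. Qed.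

Lemma lexlt_trans a b c : lexlt a b -> lexlt b c -> lexlt a c.
Proof.
elim: a b c => [|i a IH] [|j b] [|k c] //=.
case/orP=> [ij|/andP[/eqP-> ab]] /orP[jk|/andP[/eqP<- bc]].
- by rewrite (ltn_trans ij jk).
- by rewrite ij.
- by rewrite jk.
- by rewrite eqxx (IH b) ?orbT.
Qed.

Lemma lexlt_total a b : [|| a == b, lexlt a b | lexlt b a].
Proof.
elim: a b => [|i a IH] [|j b] //=; rewrite eqseq_cons.
by have := IH b; case: (ltngtP i j) => //=; rewrite ?orbT.
Qed.

Lemma lexlt_addm a b c : size a = size b -> size a = size c ->
  lexlt (addm a c) (addm b c) = lexlt a b.
Proof.
elim: a b c => [|i a IH] [|j b] [|k c] //= [sab] [sac].
by rewrite ltn_add2r eqn_add2r IH.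
Qed.

(* The degree-lexicographic order on exponent vectors. *)
Definition dlt a b := (sumn a < sumn b)%N || (sumn a == sumn b) && lexlt a b.

Definition dle a b := (a == b) || dlt a b.

Lemma dltE a b : dlt a b = lexlt (sumn a :: a) (sumn b :: b). Proof. by []. Qed.

Lemma dltnn a : dlt a a = false.
Proof. by rewrite dltE lexltnn. Qed.

Lemma dlt_trans a b c : dlt a b -> dlt b c -> dlt a c.
Proof. by rewrite !dltE; exact: lexlt_trans. Qed.

Lemma dle_trans : transitive dle.
Proof.
move=> b a c /predU1P[->//|ab] /predU1P[<-|bc]; first by rewrite /dle ab orbT.
by rewrite /dle (dlt_trans ab bc) orbT.
Qed.

Lemma dle_total : total dle.
Proof.
move=> a b; have := lexlt_total (sumn a :: a) (sumn b :: b).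
rewrite -!dltE => /or3P[/eqP[_ ->]|h|h]; rewrite /dle ?eqxx ?h ?orbT //.
Qed.

Lemma dlt_geF a b : dlt a b -> dle b a = false.
Proof.
move=> ab; apply/negbTE/negP => /predU1P[ba|ba]; first by rewrite ba dltnn in ab.
by have := dlt_trans ab ba; rewrite dltnn.
Qed.

Lemma dlt_addm a b c : size a = size b -> size a = size c ->
  dlt (addm a c) (addm b c) = dlt a b.
Proof.
move=> sab sac; rewrite /dlt !sumn_addm -?sab // ltn_add2r eqn_add2r.
by rewrite lexlt_addm.
Qed.

(** * Monomials and the Hilbert function of the ideal generated by a sequence *)

Section Monomials.
Variable A : comNzRingType.
Implicit Types (x : seq A) (a b : seq nat) (J K Q : set A).

Fixpoint mon x a : A :=
  match x, a with y :: x', i :: a' => y ^+ i * mon x' a' | _, _ => 1 end.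

Lemma mon_addm x a b : size a = size x -> size b = size x ->
  mon x (addm a b) = mon x a * mon x b.
Proof.
elim: x a b => [|y x IH] [|i a] [|j b] //=; rewrite ?mulr1 // => -[sa] [sb].
by rewrite IH // exprD; ring.
Qed.

Lemma mon0 x : mon x (nseq (size x) 0%N) = 1.
Proof. by elim: x => //= y x ->; rewrite mulr1. Qed.

Lemma mon_single x y : y \in x -> exists b, [/\ size b = size x, sumn b = 1%N & mon x b = y].
Proof.
elim: x => //= z x IH; rewrite inE => /predU1P[->|/IH[b [sb b1 <-]]].
  exists (1%N :: nseq (size x) 0%N); split; rewrite /= ?size_nseq //.
    by rewrite sumn_nseq.
  by rewrite mon0 mulr1.
by exists (0%N :: b); split; rewrite /= ?sb ?b1 // mul1r.
Qed.

Lemma mon_powid x Q n a : (forall y, y \in x -> powid Q n y) -> size a = size x ->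
  powid Q (n * sumn a) (mon x a).
Proof.
elim: x a => [|y x IH] [|i a] //= hx; first by rewrite muln0.
move=> [sa]; rewrite mulnDr; apply: powid_mulD; last first.
  by apply: IH => // z zx; apply: hx; rewrite inE zx orbT.
have {hx}Qy := hx y (mem_head _ _); elim: i => [|i IHi]; first by rewrite muln0.
by rewrite exprS mulnS; apply: powid_mulD.
Qed.

Lemma mon_powid_seqid x a n : size a = size x -> (n <= sumn a)%N ->
  powid (seqid x) n (mon x a).
Proof.
move=> sa na; apply: (powid_decr na); rewrite -[sumn a]mul1n; apply: mon_powid => // y yx.
by rewrite powid1; [exact: seqid_mem|exact: seqid_ideal].
Qed.

Lemma powid_mon_sub x n K : is_ideal K ->
  (forall a, size a = size x -> sumn a = n -> K (mon x a)) -> powid (seqid x) n `<=` K.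
Proof.
elim: n K => [|n IH] K hK h.
  rewrite (ideal_top hK) // -(mon0 x); apply: h; first exact: size_nseq.
  by rewrite sumn_nseq.
apply: mul_sub => // q y xq ny.
suff : powid (seqid x) n `<=` colon1 K q by apply.
apply: IH; first exact: is_ideal_colon1.
move=> a sa an; suff : seqid x `<=` colon1 K (mon x a).
  by rewrite /colon1 /= mulrC; apply.
apply: seqid_sub; first exact: is_ideal_colon1.
move=> z /mon_single[b [sb b1 <-]]; rewrite /colon1 /= -mon_addm //.
by apply: h; rewrite ?size_addm ?sumn_addm ?sa ?sb // an b1 addn1.
Qed.

Definition above x a : set A :=
  ideal_gen [set y | exists2 b, size b = size x /\ dlt a b & y = mon x b].

(* The coefficients of [x ^ a] that are absorbed by larger monomials: these ideals grow with [a],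
   so that their colengths are antitone, and the Hilbert function of [seqid x] sums them. *)
Definition lead_colon x a : set A := colon1 (above x a) (mon x a).

Definition lead_len x a : nat := quot_length (lead_colon x a) setT.

Lemma above_ideal x a : is_ideal (above x a). Proof. exact: gen_ideal. Qed.

Lemma above_mem x a b : size b = size x -> dlt a b -> above x a (mon x b).
Proof. by move=> sb ab; apply: sub_gen; exists b. Qed.

Lemma above_sub x a K : is_ideal K ->
  (forall b, size b = size x -> dlt a b -> K (mon x b)) -> above x a `<=` K.
Proof. by move=> hK h; apply: gen_sub => // _ [b [sb ab] ->]; apply: h. Qed.

Lemma lead_colon_ideal x a : is_ideal (lead_colon x a).
Proof. exact/is_ideal_colon1/above_ideal. Qed.

(** The order is compatible with addition, so multiplying by x^c turns a relation for x^a into one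
    for x^(a+c). *)
Lemma lead_colon_mono x a b : size a = size x -> all2 leq a b ->
  lead_colon x a `<=` lead_colon x b.
Proof.
move=> sa /addm_leq[c sc ->] r; rewrite /lead_colon /colon1 /= => har.
rewrite mon_addm ?sc // -mulrA mulrCA.
suff : above x a `<=` colon1 (above x (addm a c)) (mon x c) by apply.
apply: above_sub; first exact/is_ideal_colon1/above_ideal.
move=> b' sb' ab; rewrite /colon1 /= mulrC -mon_addm ?sc //.
by apply: above_mem; rewrite ?size_addm ?dlt_addm ?sb' ?sc ?sa.
Qed.

Lemma lead_colon_sub x a : size a = size x -> seqid x `<=` lead_colon x a.
Proof.
move=> sa; apply: seqid_sub; first exact: lead_colon_ideal.
move=> y /mon_single[b [sb b1 <-]]; rewrite /lead_colon /colon1 /= -mon_addm //.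
by apply: above_mem; rewrite ?size_addm ?sa ?sb // /dlt sumn_addm ?sa ?sb // b1 addn1 leqnn.
Qed.

Section LeadLength.
Variable x : seq A.
Hypothesis finx : finlen (seqid x) setT.

Lemma finlen_lead_colon a : size a = size x -> finlen (lead_colon x a) setT.
Proof.
move=> sa; apply: (finlen_sub finx) => //; first exact: lead_colon_ideal.
exact: lead_colon_sub.
Qed.

Lemma antitone_lead_len : antitone (size x) (lead_len x).
Proof.
move=> a b sa ab; apply: len_mono; [exact: finlen_lead_colon|exact: lead_colon_ideal| |by []].
exact: lead_colon_mono.
Qed.

(** The head of [s] is adjoined last: with [s] sorted, larger monomials come before smaller ones. *)
Definition add_mons J (s : seq (seq nat)) := foldr (fun a I => addp I (mon x a)) J s.

Lemma add_mons_ideal J s : is_ideal J -> is_ideal (add_mons J s).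
Proof. by move=> hJ; elim: s => //= a s; exact: is_ideal_addp. Qed.

Lemma add_mons_sub J s : J `<=` add_mons J s.
Proof. by elim: s => //= a s IH; apply: subset_trans IH (@addp_sub _ _ _). Qed.

Lemma add_mons_mem J s b : is_ideal J -> b \in s -> add_mons J s (mon x b).
Proof.
move=> hJ; elim: s => //= a s IH; rewrite inE => /predU1P[->|/IH].
  exact/addp_mem/add_mons_ideal.
exact: addp_sub.
Qed.

(** Adjoining x^a adds the colength of a colon ideal. This colon contains [lead_colon x a], as all
    larger monomials are already present, and equals it if everything present lies in [above x a].
    The second alternative in the covering hypothesis accounts for the monomials still to be
    adjoined. *)
Lemma len_add_mons J s : is_ideal J -> sorted dle s ->
  (forall b, b \in s -> size b = size x) ->
  (forall b, size b = size x -> b \notin s -> J (mon x b) \/ all (dle b) s) ->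
  [/\ finlen J (add_mons J s),
      (quot_length J (add_mons J s) <= \sum_(a <- s) lead_len x a)%N
    & uniq s -> (forall a, a \in s -> J `<=` above x a) ->
      quot_length J (add_mons J s) = (\sum_(a <- s) lead_len x a)%N].
Proof.
move=> hJ; elim: s => [|a s IH] ss sizes cov.
  by rewrite big_nil /= len_refl //; split=> //; exact: finlen_refl.
have alls : all (dle a) s by move: ss; rewrite /= (path_sortedE dle_trans) => /andP[].
have [|||fs les eqs] := IH.
- exact: path_sorted ss.
- by move=> b bs; apply: sizes; rewrite inE bs orbT.
- move=> b sb bs; have [->|ba] := eqVneq b a; first by right.
  have [|//|/= /andP[_ h]] := cov b sb; last by right.
    by rewrite inE (negbTE ba).
  by left.
have sa : size a = size x by apply: sizes; rewrite mem_head.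
have hK := add_mons_ideal s hJ.
have sub1 : lead_colon x a `<=` colon1 (add_mons J s) (mon x a).
  move=> r; rewrite /lead_colon /colon1 /=; apply: above_sub => // b sb ab.
  have [bs|bs] := boolP (b \in s); first exact: add_mons_mem.
  have [||/= /andP[+ _]] := cov b sb.
  - rewrite inE (negbTE bs) orbF; apply/eqP => ba; by rewrite ba dltnn in ab.
  - exact: add_mons_sub.
  - by rewrite dlt_geF.
have fc : finlen (colon1 (add_mons J s) (mon x a)) setT.
  by apply: (finlen_sub (finlen_lead_colon sa)) => //; exact: is_ideal_colon1.
have f1 : finlen (add_mons J s) (add_mons J (a :: s)) by apply/finlen_addp.
have f2 := finlen_trans fs f1.
have lenE : quot_length J (add_mons J (a :: s)) =
    (quot_length J (add_mons J s) + quot_length (colon1 (add_mons J s) (mon x a)) setT)%N.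
  rewrite -len_addp // -len_add //; [exact: add_mons_sub|exact: addp_sub].
split=> //.
  rewrite lenE big_cons addnC leq_add //; apply: len_mono => //; last exact: is_ideal_colon1.
  exact: finlen_lead_colon.
move=> /= /andP[as_ us] Jabove; rewrite lenE big_cons eqs //; last first.
  by move=> b bs; apply: Jabove; rewrite inE bs orbT.
rewrite addnC; congr (quot_length _ _ + _)%N; apply/seteqP; split=> //.
suff sub2 : add_mons J s `<=` above x a by move=> r /sub2.
have {}Jabove := Jabove a (mem_head _ _).
elim: s {IH ss cov les eqs fs hK sub1 fc f1 f2 lenE us} alls as_ sizes => //= b s IHs.
move=> /andP[ab alls]; rewrite inE negb_or => /andP[nab as_] sizes.
apply: addp_lub; first exact: above_ideal.
  by apply: IHs => // c; rewrite inE => /predU1P[->|cs]; apply: sizes; rewrite !inE ?eqxx ?cs ?orbT.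
apply: above_mem; first by apply: sizes; rewrite !inE eqxx orbT.
by move: ab; rewrite /dle (negbTE nab).
Qed.

Lemma len_monomial_cover J (D : seq (seq nat)) : is_ideal J ->
  (forall b, b \in D -> size b = size x) ->
  (forall b, size b = size x -> b \notin D -> J (mon x b)) ->
  [/\ finlen J setT, (quot_length J setT <= \sum_(a <- D) lead_len x a)%N
    & uniq D -> (forall a, a \in D -> J `<=` above x a) ->
      quot_length J setT = (\sum_(a <- D) lead_len x a)%N].
Proof.
move=> hJ sizes cov; pose s := sort dle D.
have [|||f le eq] := @len_add_mons J s hJ.
- exact: sort_sorted dle_total _.
- by move=> b; rewrite mem_sort; exact: sizes.
- by move=> b sb; rewrite mem_sort => bD; left; apply: cov.
have sumE : (\sum_(a <- D) lead_len x a = \sum_(a <- s) lead_len x a)%N.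
  by apply: perm_big; rewrite perm_sym perm_sort.
(* The zero exponent vector lies in [D] or is covered by [J]; its monomial is 1. *)
have top : add_mons J s = setT.
  apply: ideal_top; first exact: add_mons_ideal.
  rewrite -(mon0 x); have s0 : size (nseq (size x) 0%N) = size x by exact: size_nseq.
  have [bD|bD] := boolP (nseq (size x) 0%N \in D).
    by apply: add_mons_mem; rewrite ?mem_sort.
  by apply: add_mons_sub; apply: cov.
rewrite top in f le eq; rewrite sumE; split=> // uD hD; apply: eq.
  by rewrite sort_uniq.
by move=> a; rewrite mem_sort; exact: hD.
Qed.

(** Since the order compares degrees first, (x)^N lies in [above x a] for every [a] of degree less
    than [N], and the bound of [len_monomial_cover] becomes an equality. *)
Lemma hilbert_seqid N : finlen (powid (seqid x) N) setT /\
  quot_length (powid (seqid x) N) setT = simplex_sum (size x) (lead_len x) N.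
Proof.
have [||fN _ lenN] := @len_monomial_cover (powid (seqid x) N) (simplex (size x) N) (powid_ideal _ _).
- by move=> b; rewrite mem_simplex => /andP[/eqP].
- move=> b sb; rewrite mem_simplex sb eqxx -leqNgt; exact: mon_powid_seqid.
split=> //; apply: lenN; first exact: simplex_uniq.
move=> a; rewrite mem_simplex => /andP[/eqP sa aN].
apply: powid_mon_sub; first exact: above_ideal.
by move=> b sb bN; apply: above_mem => //; rewrite /dlt bN aN.
Qed.

End LeadLength.

Definition hilbert Q N := quot_length (powid Q N) setT.

(** The multiplicity as a natural number, read off from a stable difference; [multiplicityE] ties it
    to the rational coefficient when [size x] is the dimension. *)
Definition has_mult x (L : nat) :=
  eventual_degree (size x) L%:Z (fun N => (hilbert (seqid x) N)%:Z).

Lemma has_mult_min x : finlen (seqid x) setT ->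
  exists2 L, is_minimum (size x) (lead_len x) L & has_mult x L.
Proof.
move=> finx; have [L [minL degL]] := simplex_sum_degree (antitone_lead_len finx).
exists L => //; apply: (eventual_degree_ext (N0 := 0%N)) degL => N _.
by rewrite /hilbert (hilbert_seqid finx N).2.
Qed.

Lemma has_mult_unique x L L' : has_mult x L -> has_mult x L' -> L = L'.
Proof.
move=> h h'; apply/eqP; rewrite eqn_leq; apply/andP; split.
  by apply: (eventual_degree_leq (N0 := 0%N) h h').
by apply: (eventual_degree_leq (N0 := 0%N) h' h).
Qed.

Lemma has_mult_perm x y L : perm_eq x y -> has_mult x L -> has_mult y L.
Proof. by move=> xy; rewrite /has_mult (perm_size xy) (seqid_eq (perm_mem xy)). Qed.

(** Dividing the exponent of y by [n] shows that a monomial lies in (y^n, s)^N unless its quotient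
    vector has degree less than [N]. The exceptions form [D], which is only a cover, so that an
    inequality results. *)
Lemma has_mult_head n y s L L' : (0 < n)%N -> finlen (seqid (y :: s)) setT ->
  has_mult (y :: s) L -> has_mult (y ^+ n :: s) L' -> (L' <= n * L)%N.
Proof.
move=> n0 finx hL hL'; have [M minM hM] := has_mult_min finx.
rewrite (has_mult_unique hL hM).
have anti := antitone_lead_len finx.
have [M' [minM' degM']] := simplex_sum_degree (antitone_dilate_head n anti).
rewrite -(is_minimum_unique minM' (is_minimum_dilate_head n0 anti minM)).
apply: (eventual_degree_leq (N0 := 0%N)) hL' degM' _ => N _.
pose D := [seq (n * head 0%N a + r)%N :: behead a | a <- simplex (size (y :: s)) N, r <- iota 0 n].
have -> : simplex_sum (size (y :: s)) (dilate_head n (lead_len (y :: s))) N =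
    (\sum_(a <- D) lead_len (y :: s) a)%N.
  rewrite /D big_allpairs_dep /simplex_sum; apply: eq_bigr => a _.
  rewrite /dilate_head /= -(big_mkord xpredT (fun r => lead_len (y :: s) ((n * head 0 a + r) :: behead a)%N)).
  by rewrite /index_iota subn0.
have [||_ + _] := @len_monomial_cover (y :: s) finx (powid (seqid (y ^+ n :: s)) N) D
  (powid_ideal _ _); last by [].
  move=> b /allpairsPdep[a [r [+ _ ->]]]; rewrite mem_simplex => /andP[/eqP + _].
  by case: a => //= i a [->].
move=> [//|j b] [sb] bD.
have Nb : (N <= sumn ((j %/ n)%N :: b))%N.
  rewrite leqNgt; apply: contra bD => Nb; apply/allpairsPdep.
  exists ((j %/ n)%N :: b), (j %% n)%N; split.
  - by rewrite mem_simplex /= sb eqxx.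
  - by rewrite mem_iota add0n ltn_mod.
  - by rewrite /= mulnC -divn_eq.
have := @mon_powid_seqid (y ^+ n :: s) ((j %/ n)%N :: b) N.
rewrite /= sb => /(_ erefl Nb) /(idealM (y ^+ (j %% n)) (powid_ideal _ _)).
by rewrite mulrA -exprM -exprD addnC mulnC -divn_eq.
Qed.

(** The N-th power of the ideal of n-th powers lies in (x)^(nN), whose Hilbert function has top
    difference n^d L. *)
Lemma has_mult_pow n x L L' : (0 < n)%N -> finlen (seqid x) setT ->
  finlen (seqid [seq y ^+ n | y <- x]) setT ->
  has_mult x L -> has_mult [seq y ^+ n | y <- x] L' -> (n ^ size x * L <= L')%N.
Proof.
move=> n0 finx finxn hL; rewrite /has_mult size_map => hL'.
have deg := eventual_degree_mul n0 hL.
have {}deg : eventual_degree (size x) (n ^ size x * L)%N%:Z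
    (fun N => (hilbert (seqid x) (n * N))%:Z).
  by rewrite mulnC -[in X in eventual_degree _ X _]natz natrM mulr_natr natz.
apply: (eventual_degree_leq (N0 := 0%N)) deg hL' _ => N _.
apply: len_mono => //; [exact: (hilbert_seqid finxn N).1|exact: powid_ideal|].
apply: powid_mon_sub; first exact: powid_ideal.
move=> a sa aN; apply: (powid_decr (leqnn _)); rewrite -aN.
rewrite size_map in sa.
have -> : mon [seq y ^+ n | y <- x] a = mon x [seq (n * i)%N | i <- a].
  elim: x a sa {finx finxn hL aN} => [|y x IH] [|i a] //= [sa].
  by rewrite -exprM IH.
have -> : (n * sumn a = sumn [seq n * i | i <- a])%N.
  by elim: a {sa aN} => [|i a /= <-]; rewrite ?muln0 ?mulnDr.
by apply: mon_powid_seqid; rewrite ?size_map.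
Qed.

End Monomials.

(** * Multiplicities of parameter ideals *)

Section ParameterIdeals.
Variables (A : comNzRingType) (m : set A).
Hypotheses (noeA : noetherian A) (locA : local_ring m).
Implicit Types (I J K P Q : set A) (x s : seq A) (a b t : A).

Let finprim J : is_ideal J -> primary m J -> finlen J setT.
Proof. exact: finlen_primary. Qed.

Lemma primary_seqid_pow n s1 s2 : primary m (seqid (s1 ++ s2)) ->
  primary m (seqid ([seq y ^+ n | y <- s1] ++ s2)).
Proof.
elim: s1 s2 => [//|y s1 IH] s2 /= h.
have {IH}/IH : primary m (seqid (s1 ++ y :: s2)).
  by rewrite (@seqid_eq _ _ (y :: s1 ++ s2)) // => z; rewrite !(mem_cat, inE) orbCA.
rewrite (@seqid_eq _ _ (y :: [seq y ^+ n | y <- s1] ++ s2)).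
  rewrite !seqid_cons => prim; apply: primary_addp_exp => //; exact: seqid_ideal.
by move=> z; rewrite !(mem_cat, inE) orbCA.
Qed.

Lemma has_mult_ex x : primary m (seqid x) -> exists L, has_mult x L.
Proof.
move=> prim; have [|L _ hL] := @has_mult_min _ x; last by exists L.
exact/finprim/prim/seqid_ideal.
Qed.

Lemma has_mult_pow_le n s1 s2 L L' : (0 < n)%N -> primary m (seqid (s1 ++ s2)) ->
  has_mult (s1 ++ s2) L -> has_mult ([seq y ^+ n | y <- s1] ++ s2) L' ->
  (L' <= n ^ size s1 * L)%N.
Proof.
move=> n0; elim: s1 s2 L L' => [|y s1 IH] s2 L L' /= prim hL hL'.
  by rewrite mul1n (has_mult_unique hL hL').
have mid s : perm_eq (s ++ y :: s2) (y :: s ++ s2) by rewrite perm_catC /= perm_cons perm_catC.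
have prim1 : primary m (seqid (s1 ++ y :: s2)) by rewrite (seqid_eq (perm_mem (mid s1))).
have prim2 := primary_seqid_pow n prim1.
have [L1 hL1] := has_mult_ex prim2.
have le1 : (L1 <= n ^ size s1 * L)%N.
  by apply: IH prim1 _ hL1; apply: has_mult_perm hL; rewrite perm_sym.
have le2 : (L' <= n * L1)%N.
  apply: has_mult_head n0 _ (has_mult_perm (mid _) hL1) hL'.
  by rewrite -(seqid_eq (perm_mem (mid _))); apply: finprim prim2; exact: seqid_ideal.
by apply: (leq_trans le2); rewrite expnS -mulnA leq_mul2l le1 orbT.
Qed.

(* Each single power multiplies the multiplicity by at most [n], while raising all [d] generators
   to the power [n] multiplies it by at least [n ^ d]; hence equality throughout. *)
Lemma has_mult_head_pow n a s L : (0 < n)%N -> primary m (seqid (a :: s)) ->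
  has_mult (a :: s) L -> has_mult (a ^+ n :: s) (n * L).
Proof.
move=> n0 prim hL.
have prim1 : primary m (seqid (a ^+ n :: s)).
  by apply: (@primary_seqid_pow n [:: a] s).
have [L1 hL1] := has_mult_ex prim1.
suff <- : L1 = (n * L)%N by [].
apply/eqP; rewrite eqn_leq; apply/andP; split.
  by apply: has_mult_head n0 _ hL hL1; apply: finprim prim; exact: seqid_ideal.
have prim2 : primary m (seqid [seq y ^+ n | y <- a :: s]).
  by rewrite -[map _ _]cats0; apply: primary_seqid_pow; rewrite cats0.
have [L2 hL2] := has_mult_ex prim2.
have le1 : (n ^ size (a :: s) * L <= L2)%N.
  by apply: has_mult_pow n0 _ _ hL hL2; apply: finprim => //; exact: seqid_ideal.
have p1 : perm_eq (a ^+ n :: s) (s ++ [:: a ^+ n]) by rewrite perm_sym perm_catC.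
have le2 : (L2 <= n ^ size s * L1)%N.
  apply: (@has_mult_pow_le n s [:: a ^+ n]) => //.
  - by rewrite -(seqid_eq (perm_mem p1)).
  - exact: has_mult_perm hL1.
  - by apply: has_mult_perm hL2; rewrite perm_sym perm_catC.
have := leq_trans le1 le2; rewrite /= expnS -mulnA mulnCA leq_pmul2l //.
by rewrite expn_gt0 n0.
Qed.

Lemma hilbert_samuel_unique (p q : {poly rat}) N0 :
  (forall N, (N0 <= N)%N -> p.[N%:R] = q.[N%:R]) -> p = q.
Proof.
move=> h; apply/eqP; rewrite -subr_eq0 -lead_coef_eq0 eq_le.
rewrite -(oppr_ge0 (lead_coef _)) -lead_coefN opprB.
by apply/andP; split; apply: (@lead_coef_ge0 _ N0) => N /h; rewrite hornerD hornerN => ->; rewrite subrr.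
Qed.

Lemma multiplicityE x L : size x = krull_dim A -> has_mult x L -> multiplicity (seqid x) = L%:R.
Proof.
move=> sx; rewrite /has_mult sx => /eventual_degree_poly[p [_ pd [N0 pE]]].
rewrite /multiplicity mulrC; have -> : hilbert_samuel_poly (seqid x) = p.
  rewrite /hilbert_samuel_poly; set S := [set _ | _].
  have : exists q, S q by exists p; exists N0 => N /pE.
  move=> /(xgetPex 0)[N1 h]; apply: (@hilbert_samuel_unique _ _ (maxn N0 N1)) => N.
  by rewrite geq_max => /andP[/pE-> /h->].
by rewrite pd.
Qed.

Lemma sop_primary x : system_of_parameters m x -> primary m (seqid x).
Proof. by rewrite seqidE; case. Qed.

Lemma sop_parameter_ideal x : system_of_parameters m x -> parameter_ideal m (seqid x).
Proof. by exists x; rewrite seqidE. Qed.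

Lemma sop_head a b s : system_of_parameters m (a :: s) -> m b ->
  primary m (seqid (b :: s)) -> system_of_parameters m (b :: s).
Proof.
move=> [sz ms _] mb; rewrite seqidE => prim; split => // y; rewrite inE => /predU1P[->//|ys].
by apply: ms; rewrite inE ys orbT.
Qed.

Lemma sop_pow n a s : (0 < n)%N -> system_of_parameters m (a :: s) ->
  system_of_parameters m (a ^+ n :: s).
Proof.
case: n => // n _ sop; apply: (sop_head sop).
  by rewrite exprS; apply: idealMr; [exact: max_ideal locA|case: sop => _ + _; apply; rewrite mem_head].
exact: (@primary_seqid_pow n.+1 [:: a] s) (sop_primary sop).
Qed.

Lemma sop_perm x y : perm_eq x y -> system_of_parameters m x -> system_of_parameters m y.
Proof.
move=> xy [sz ms prim]; split; first by rewrite -(perm_size xy).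
  by move=> z; rewrite -(perm_mem xy); exact: ms.
by rewrite -seqidE -(seqid_eq (perm_mem xy)) seqidE.
Qed.

(** (P + a^n A)/(P + a^(n+1) A) is cyclic, and the annihilator of its generator a^n is (P : a^n) +
    aA. *)
Lemma len_addp_exp P a n : is_ideal P -> primary m (addp P a) ->
  quot_length (addp P (a ^+ n.+1)) setT =
  (quot_length (addp P (a ^+ n)) setT + quot_length (addp (colon1 P (a ^+ n)) a) setT)%N.
Proof.
move=> hP prim; have hS := is_ideal_addp (a ^+ n.+1) hP; have hn := is_ideal_addp (a ^+ n) hP.
have sub : addp P (a ^+ n.+1) `<=` addp P (a ^+ n).
  by move=> x [c Px]; exists (a * c); rewrite mulrA -exprSr.
rewrite (len_add (finprim hS (primary_addp_exp _ hP prim)) hn sub) // addnC.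
congr (_ + _)%N.
have -> : addp P (a ^+ n) = addp (addp P (a ^+ n.+1)) (a ^+ n).
  apply/seteqP; split; last by apply: addp_lub => //; exact: addp_mem.
  by apply: addp_lub; [exact: is_ideal_addp|apply: subset_trans (@addp_sub _ _ _) (@addp_sub _ _ _)|exact: addp_mem].
rewrite len_addp //; congr quot_length; apply/seteqP; split=> x.
  by move=> [c Pc]; exists c; rewrite /colon1 /= mulrBr mulrA -exprSr.
by move=> [c]; rewrite /colon1 /= mulrBr mulrA -exprSr => Pc; exists c.
Qed.

(* [A / P] localized at [a] is Artinian, so the powers of [t] stabilize there. *)
Lemma pow_stab P a t : is_ideal P -> m a -> primary m (addp P a) ->
  exists j n c, P (a ^+ j * t ^+ n - t ^+ n.+1 * c).
Proof.
move=> hP ma prim.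
(* [E n] is the contraction to A of the ideal generated by t^n in the localization of A/P at [a]. *)
pose E n := [set x | exists j, addp P (t ^+ n) (a ^+ j * x)].
have hE n : is_ideal (E n).
  have ht := is_ideal_addp (t ^+ n) hP; split.
  - by exists 0%N; rewrite mulr0; exact: ideal0.
  - move=> x y [i Ex] [j Ey]; exists (i + j)%N.
    rewrite (_ : _ * _ = a ^+ j * (a ^+ i * x) + a ^+ i * (a ^+ j * y)); last by rewrite exprD; ring.
    by apply: idealD => //; apply: idealM.
  - by move=> b x [i Ex]; exists i; rewrite mulrCA; apply: idealM.
have EE i j : (i <= j)%N -> E j `<=` E i.
  move=> ij x [k [c Pc]]; exists k; exists (t ^+ (j - i) * c).
  by rewrite mulrA -exprD subnKC.
have PE n : P `<=` E n by move=> x Px; exists 0%N; apply: addp_sub; rewrite expr0 mul1r.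
have addpS J K : J `<=` K -> addp J a `<=` addp K a by move=> JK x [c /JK Kc]; exists c.
pose v n := quot_length (addp P a) (addp (E n) a).
have fin n : finlen (addp P a) (addp (E n) a).
  apply: (finlen_sub (finprim _ prim)) => //; try exact: is_ideal_addp.
  exact: addpS.
have vE i j : (i <= j)%N -> v i = (v j + quot_length (addp (E j) a) (addp (E i) a))%N.
  move=> ij; apply: len_add; first exact: fin.
  - exact: is_ideal_addp.
  - exact: addpS.
  - exact/addpS/EE.
have [|N hN] := @nat_stab v; first by move=> i j /vE->; exact: leq_addr.
have eqE : addp (E N.+1) a = addp (E N) a.
  apply: len_eq0.
    apply: (finlen_sub (fin N)); try exact: is_ideal_addp; first exact: addpS.
      exact/addpS/EE.
    by [].
  by have := vE N N.+1 (leqnSn N); rewrite hN //; lia.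
(* [E N] is saturated with respect to [a]: if a c lies in it, so does c. Hence E N <= E N.+1 + m E
   N, and Nakayama's lemma applies. *)
have sub : E N `<=` E N.+1.
  apply: (nakayama noeA locA) => //; move=> x Ex.
  have [c Ec] : addp (E N.+1) a x by rewrite eqE; exact: addp_sub.
  have [j Ej] : E N (a * c).
    by rewrite -(subKr x (a * c)); apply: idealB => //; apply: (EE N N.+1).
  exists (a * c) => //; apply: mul_mem => //; exists j.+1.
  by rewrite exprSr -mulrA.
have [|j [c Pc]] := sub (t ^+ N); last by exists j, N, c.
by exists 0%N; rewrite expr0 mul1r; exact: addp_mem.
Qed.

(** * Colons and socles modulo parameters in a Buchsbaum ring *)

Section Buchsbaum.
Hypothesis buchA : forall Q Q', parameter_ideal m Q -> parameter_ideal m Q' ->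
  (quot_length Q setT)%:R - multiplicity Q = (quot_length Q' setT)%:R - multiplicity Q'.

(** Invariance of length minus multiplicity is applied to (a^n, P) and (a, P), whose multiplicities
    are n e and e; the identity is written additively to stay in [nat]. *)
Lemma sop_len a s : system_of_parameters m (a :: s) -> exists e, forall n, (0 < n)%N ->
  (quot_length (addp (seqid s) (a ^+ n)) setT + e =
   quot_length (addp (seqid s) a) setT + n * e)%N.
Proof.
move=> sop; have [e he] := has_mult_ex (sop_primary sop); exists e => n n0.
have sopn := sop_pow n0 sop.
have := buchA (sop_parameter_ideal sopn) (sop_parameter_ideal sop).
rewrite (multiplicityE _ he); last by case: sop.
rewrite (multiplicityE _ (has_mult_head_pow n0 (sop_primary sop) he)); last by case: sopn.
move/(congr1 (fun u => u + e%:R + (n * e)%:R)); rewrite subrK addrAC subrK -!natrD.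
by move/eqP; rewrite eqr_nat -!seqid_cons => /eqP.
Qed.

(* By [sop_len], [a ^ k A / a ^ k.+1 A] has the same length in [A / P] for all [k >= 1], so that
   [P : a ^ k.+1] is contained in [(P : a) + a A]. *)
Lemma colon_pow n a s : system_of_parameters m (a :: s) ->
  colon1 (seqid s) (a ^+ n) `<=` colon1 (seqid s) a.
Proof.
move=> sop; set P := seqid s; have hP : is_ideal P := seqid_ideal s.
have prim : primary m (addp P a) by rewrite /P -seqid_cons; exact: sop_primary.
have ma : m a by case: sop => _ + _; apply; rewrite mem_head.
have [e] := sop_len sop; rewrite -/P => he.
pose U k := colon1 P (a ^+ k); have hU k : is_ideal (U k) := is_ideal_colon1 _ hP.
have UU k : U k `<=` U k.+1.
  by move=> x Ux; rewrite /U /colon1 /= exprS -mulrA; exact: (idealM a hP Ux).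
have UUle k : U 1%N `<=` U k.+1 by elim: k => [//|k IH]; apply: subset_trans (UU _).
have lenU k : (0 < k)%N -> quot_length (addp (U k) a) setT = e.
  by move=> k0; have := len_addp_exp k hP prim; have := he k k0; have := he k.+1 isT; rewrite /U mulSn; lia.
have prim1 k : primary m (addp (U k) a).
  by apply: primaryS prim => x [c Pc]; exists c; exact: (colon1_sub (a ^+ k) hP Pc).
have Usub k : U k.+1 `<=` addp (U 1%N) a.
  rewrite (@len_inj _ (addp (U 1%N) a) (addp (U k.+1) a) setT); first exact: addp_sub.
  - by apply: finprim => //; exact: is_ideal_addp.
  - exact: is_ideal_addp.
  - by move=> x [c Uc]; exists c; apply: UUle.
  - by [].
  - by rewrite !lenU.
have [N UN] := noeth_stab noeA hU UU.
rewrite -[X in colon1 P X]expr1 -/(U 1%N); apply: subset_trans (UN n) _.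
apply: subset_trans (UU N) _.
(* Here x = w + a c with w in [U 1], and c lies in [U N.+2], hence in [U N]; so U N.+1 <= U 1 + m U
   N.+1. *)
apply: (nakayama noeA locA) => // x UNx; have [c Uc] := Usub _ _ UNx.
exists (a * c) => //; apply: mul_mem => //; apply: UU; apply: (UN N.+2).
have Nc : U N.+1 (a * c).
  by rewrite -(subKr x (a * c)); exact: (idealB (hU N.+1) UNx (UUle _ _ Uc)).
by move: Nc; rewrite /U /colon1 /= mulrA -exprSr.
Qed.

(** Some power of [b] lies in P + aA and so multiplies P : a into P; [colon_pow] reduces this power
    to [b] itself. *)
Lemma colon_parameter a b s : system_of_parameters m (a :: s) ->
  system_of_parameters m (b :: s) -> colon1 (seqid s) a `<=` colon1 (seqid s) b.
Proof.
move=> sopa sopb x Px.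
have [|k] := primary_mem_exp (sop_primary sopa) (x := b).
  by case: sopb => _ + _; apply; rewrite mem_head.
rewrite seqid_cons => -[c Pc]; apply: (colon_pow (n := k) sopb).
have hP := seqid_ideal s; rewrite /colon1 /= -(subrK (a * c) (b ^+ k)) mulrDl.
apply: (idealD hP); first exact: (idealMr x hP Pc).
by rewrite mulrAC; exact: (idealMr c hP Px).
Qed.

(** An element [t] of [m] need not be a parameter modulo P. It is corrected by a multiple of [a],
    which does not change its product with [w] modulo P. *)
Lemma colon_max a s t w : system_of_parameters m (a :: s) ->
  colon1 (seqid s) a w -> m t -> seqid s (t * w).
Proof.
move=> sop Ww mt; set P := seqid s; have hP : is_ideal P := seqid_ideal s.
have prim : primary m (addp P a) by rewrite /P -seqid_cons; exact: sop_primary.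
have ma : m a by case: sop => _ + _; apply; rewrite mem_head.
have [N [n [c Pc]]] := pow_stab t hP ma prim.
(* [b] is a parameter modulo [P], since [t ^ n.+1] is [t ^ n b] modulo [P]; so [b] kills [w], as [a] does. *)
pose b := t * (1 - a * c) + a ^+ N.+1.
have Ptb : P (t ^+ n * b - t ^+ n.+1).
  rewrite (_ : _ - _ = a * (a ^+ N * t ^+ n - t ^+ n.+1 * c)); first exact: idealM.
  by rewrite /b !exprS; ring.
have hb := is_ideal_addp b hP.
have tb : addp P b (t ^+ n.+1).
  exists (t ^+ n); rewrite (_ : _ - _ = - (t ^+ n * b - t ^+ n.+1)); last by ring.
  exact: idealN.
(* Modulo P + bA, a^(N+1) is a multiple of t, and t^(n+1) vanishes; so P + bA contains a power of
   [a], which makes [b] a parameter. *)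
have ab : addp P b (a ^+ N.+1 - t * (a * c - 1)).
  by exists 1; rewrite /b (_ : _ - _ = 0); [exact: ideal0|ring].
have abk k : addp P b ((a ^+ N.+1) ^+ k - t ^+ k * (a * c - 1) ^+ k).
  elim: k => [|k IH]; first by rewrite !expr0 mul1r subrr; exact: ideal0.
  rewrite !(exprS _ k) (_ : _ - _ = a ^+ N.+1 * ((a ^+ N.+1) ^+ k - t ^+ k * (a * c - 1) ^+ k)
    + t ^+ k * (a * c - 1) ^+ k * (a ^+ N.+1 - t * (a * c - 1))); last by ring.
  by apply: idealD => //; apply: idealM.
have sopb : system_of_parameters m (b :: s).
  apply: (sop_head sop).
    apply: (idealD (max_ideal locA)); first exact: idealMr (max_ideal locA) mt.
    by rewrite exprS; apply: idealMr (max_ideal locA) ma.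
  rewrite seqid_cons; apply: (primaryS _ (primary_addp_exp (N.+1 * n.+1) hP prim)).
  apply: addp_lub => //; first exact: addp_sub.
  rewrite exprM -(subrK (t ^+ n.+1 * (a * c - 1) ^+ n.+1) (_ ^+ n.+1)).
  by apply: idealD => //; apply: idealMr.
have Pbw := colon_parameter sop sopb Ww.
rewrite (_ : t * w = b * w + (t * c - a ^+ N) * (a * w)); last by rewrite /b exprS; ring.
by apply: idealD => //; apply: idealM.
Qed.

Section Index.
Hypothesis index_const : forall Q Q', parameter_ideal m Q -> parameter_ideal m Q' ->
  quot_length Q (ideal_colon Q m) = quot_length Q' (ideal_colon Q' m).

(* Multiplication by [a] shows that ((Q + W) : m) / Q, with [W = P : a], is as long as the socle of
   A / (P + a ^ 2 A), hence by assumption as long as the socle of [A / Q] contained in it. *)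
Lemma socle_lift a s (x : A) : system_of_parameters m (a :: s) ->
  (forall t, m t -> idsum (seqid (a :: s)) (colon1 (seqid s) a) (x * t)) ->
  ideal_colon (seqid (a :: s)) m x.
Proof.
move=> sop; set P := seqid s; have hP : is_ideal P := seqid_ideal s.
rewrite seqid_cons -/P; set W := colon1 P a; set Q := addp P a.
have hW : is_ideal W by exact: is_ideal_colon1.
have hQ : is_ideal Q by exact: is_ideal_addp.
have mW t w : m t -> W w -> P (t * w) by move=> mt Ww; exact: colon_max sop Ww mt.
have ma : m a by case: sop => _ + _; apply; rewrite mem_head.
have aaW y : P (a * (a * y)) -> W y.
  by move=> h; apply: (colon_pow (n := 2) sop); rewrite /colon1 /= expr2 -mulrA.
have PW : P `<=` W by exact: colon1_sub.
pose Q2 := addp P (a ^+ 2); have hQ2 : is_ideal Q2 by exact: is_ideal_addp.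
have primQ : primary m Q by rewrite /Q /P -seqid_cons; exact: sop_primary.
have primQ2 : primary m Q2 by exact: primary_addp_exp.
pose QW := idsum Q W; have hQW : is_ideal QW by exact: is_ideal_idsum.
pose Q2W := idsum Q2 W; have hQ2W : is_ideal Q2W by exact: is_ideal_idsum.
pose K := ideal_colon QW m; have hK : is_ideal K by exact: is_ideal_colon.
have QWK : QW `<=` K by exact: colon_sub.
have QQW : Q `<=` QW by exact: idsum_subl.
have IK : ideal_colon Q m `<=` K by move=> y Iy t mt; apply: QQW; exact: Iy.
have hI : is_ideal (ideal_colon Q m) by exact: is_ideal_colon.
have hI2 : is_ideal (ideal_colon Q2 m) by exact: is_ideal_colon.
have QWE y : QW y <-> exists c, W (y - a * c).
  split=> [[z [c Pc] Wyz]|[c Wc]].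
    by exists c; rewrite (_ : _ - _ = (y - z) + (z - a * c)); [apply: idealD => //; exact: PW|ring].
  by exists (a * c); rewrite // /Q; apply: idealMr => //; exact: addp_mem.
(* For y in Q2 : m, the relation a y in P + a^2 A puts y in aA + W; the coefficient of a then lies
   in [K], because P : a^2 = W. *)
have I2E : ideal_colon Q2 m = addmul Q2W a K.
  apply/seteqP; split=> y.
    move=> Iy; have [c Pc] := Iy a ma.
    have Wyc : W (y - a * c) by rewrite /W /colon1 /= mulrBr mulrA -expr2 (mulrC a).
    exists c; last exact: idsum_subr.
    move=> t mt; apply/QWE; have [d Pd] := Iy t mt.
    exists d; apply: aaW.
    rewrite (_ : _ * _ = a * ((y * t - a ^+ 2 * d) - t * (y - a * c))); last by rewrite expr2; ring.
    by apply: idealM => //; apply: idealB => //; apply: mW.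
  move=> [k Kk [q Qq Wyq]] t mt.
  have /QWE[c Wc] := Kk t mt.
  rewrite (_ : y * t = t * (y - a * k - q) + a * (k * t - a * c) + a ^+ 2 * c + t * q); last by rewrite expr2; ring.
  apply: idealD => //; last exact: idealM.
  apply: idealD => //; last by apply: idealMr => //; exact: addp_mem.
  by apply: idealD => //; apply: addp_sub; [exact: mW|exact: Wc].
have capE : Q `&` W = P.
  apply/seteqP; split=> y; last by move=> Py; split; [exact: addp_sub|exact: PW].
  move=> [[c Pc] Wy]; have Wc : W c.
    apply: aaW; rewrite (_ : _ * _ = a * y - a * (y - a * c)); last by ring.
    by apply: idealB => //; apply: idealM.
  by rewrite -(subrK (a * c) y); apply: idealD.
have cap2E : Q2 `&` W = P.
  apply/seteqP; split=> y; last by move=> Py; split; [exact: addp_sub|exact: PW].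
  move=> [[c Pc] Wy]; rewrite -capE; split=> //; exists (a * c).
  by rewrite mulrA -expr2.
have lenW : quot_length Q QW = quot_length Q2 Q2W.
  by rewrite /QW /Q2W idsumC -len_idsum // [in RHS]idsumC -len_idsum // ![W `&` _]setIC capE cap2E.
have capK : K `&` colon1 Q2W a = QW.
  apply/seteqP; split=> y.
    move=> [_ [z [c Pc] Wz]]; apply/QWE; exists c; apply: aaW.
    rewrite (_ : _ * _ = a * (a * y - z) + a * (z - a ^+ 2 * c)); last by rewrite expr2; ring.
    by apply: idealD => //; exact: idealM.
  move=> Qy; split; first exact: QWK.
  have [c Wc] := (QWE y).1 Qy; exists (a ^+ 2 * c).
    by apply: idealMr => //; exact: addp_mem.
  rewrite (_ : _ - _ = a * (y - a * c)); last by rewrite expr2; ring.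
  exact: idealM.
have QI : Q `<=` ideal_colon Q m by exact: colon_sub.
have finK : finlen Q K.
  by apply: (finlen_sub (finprim hQ primQ)) => //; exact: subset_trans IK.
have finI2 : finlen Q2 (ideal_colon Q2 m).
  by apply: (finlen_sub (finprim hQ2 primQ2)) => //; exact: colon_sub.
(* Both lengths contain that of W/P, and [a] identifies K/(Q + W) with (Q2 : m)/(Q2 + W). *)
have lenI2 : quot_length Q2 (ideal_colon Q2 m) = quot_length Q K.
  rewrite (len_add finI2 hQ2W); [|exact: idsum_subl|by rewrite I2E; exact: addmul_sub].
  by rewrite (len_add finK hQW) // lenW I2E -len_addmul // capK.
have : quot_length Q2 (ideal_colon Q2 m) = quot_length Q (ideal_colon Q m).
  apply: index_const; rewrite /Q2 /Q /P -seqid_cons; apply: sop_parameter_ideal => //.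
  exact: sop_pow.
rewrite lenI2 (len_add finK hI QI IK) => lenIK hx.
have -> : ideal_colon Q m = K; last exact: hx.
apply: len_eq0; last by lia.
exact: (finlen_sub finK).
Qed.

End Index.
End Buchsbaum.
End ParameterIdeals.

Lemma eventual_degree_bin d c : eventual_degree d 1 (fun N => 'C(N + c, d)%:Z).
Proof.
elim: d => [|d IH]; first by exists 0%N => N _; rewrite /= bin0.
rewrite eventual_degreeS; apply: (eventual_degree_ext (N0 := 0%N)) IH => N _.
by rewrite /delta addSn binS PoszD [_ + Posz 'C(_, d)]addrC addrK.
Qed.

(** * A criterion for e(A) <= 1 *)

Section MultiplicityOne.
Variables (A : comNzRingType) (m : set A).
Hypotheses (noeA : noetherian A) (locA : local_ring m).
Hypothesis buchA : forall Q Q', parameter_ideal m Q -> parameter_ideal m Q' ->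
  (quot_length Q setT)%:R - multiplicity Q = (quot_length Q' setT)%:R - multiplicity Q'.
Implicit Types (J P Q : set A) (s : seq A).

Let hm : is_ideal m := max_ideal locA.

Lemma idsum_powid_ideal J n : is_ideal J -> is_ideal (idsum J (powid m n)).
Proof. by move=> hJ; apply: is_ideal_idsum (powid_ideal _ _). Qed.

(** The Hilbert function of the maximal ideal on A/J. *)
Definition hilbert_mod J n := quot_length (idsum J (powid m n)) setT.

Lemma finlen_hilbert_mod J n : is_ideal J -> finlen (idsum J (powid m n)) setT.
Proof.
move=> hJ; apply: (finlen_primary noeA locA) => //; first exact: idsum_powid_ideal.
by exists n; exact: idsum_subr.
Qed.

Lemma hilbert_mod0 J : is_ideal J -> hilbert_mod J 0 = 0%N.
Proof.
move=> hJ; rewrite /hilbert_mod (_ : idsum _ _ = setT); first exact/len_refl/is_ideal_setT.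
by apply/seteqP; split=> // x _; exact: idsum_subr.
Qed.

(** The kernel of A/(J + m^(n+1)) -> A/(J + yA + m^(n+1)) is generated by y and killed by J +
    m^n. *)
Lemma hilbert_modS J y n : is_ideal J -> m y ->
  (hilbert_mod J n.+1 <= hilbert_mod J n + hilbert_mod (addp J y) n.+1)%N.
Proof.
move=> hJ my; set X := idsum J (powid m n.+1).
have hX : is_ideal X by exact: idsum_powid_ideal.
have XE : addp X y = idsum (addp J y) (powid m n.+1).
  apply/seteqP; split=> x.
    move=> [c [z Jz mz]]; exists (z + y * c).
      by exists c; rewrite addrK.
    by rewrite (_ : _ - _ = x - y * c - z) //; ring.
  move=> [z [c Jc] mz]; exists c; exists (z - y * c) => //.
  by rewrite (_ : _ - _ = x - z) //; ring.
have fX := finlen_hilbert_mod n.+1 hJ.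
rewrite /hilbert_mod -/X -XE (len_add fX (is_ideal_addp y hX)) //; last exact: addp_sub.
rewrite leq_add2r len_addp //; apply: len_mono => //; first exact: finlen_hilbert_mod.
  exact: is_ideal_colon1.
move=> x [z Jz mz]; exists (y * z); first exact: idealM.
by rewrite -mulrBr; apply: mul_mem.
Qed.

(** Generators are dropped one at a time; the increments bounded by [hilbert_modS] sum, by Pascal's
    rule, to a binomial with [c] and [k] raised by one. *)
Lemma hilbert_mod_bin s c k : (forall y, y \in s -> m y) ->
  (forall n, hilbert_mod (seqid s) n <= 'C(n + c, k))%N ->
  (forall n, hilbert_mod (seqid [::]) n <= 'C(n + (c + size s), k + size s))%N.
Proof.
elim: s c k => [|y s IH] c k ms h n; first by rewrite !addn0; exact: h.
rewrite -[size (y :: s)]/(size s).+1 !(addnS _ (size s)) -(addSn c) -(addSn k).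
apply: IH => [z zs|{}n]; first by apply: ms; rewrite inE zs orbT.
have hJ := seqid_ideal s.
elim: n => [|n IHn]; first by rewrite hilbert_mod0.
apply: (leq_trans (hilbert_modS n hJ (ms y (mem_head _ _)))).
by rewrite -seqid_cons addSn binS leq_add // -addSnnS.
Qed.

Lemma multiplicity_le1 a s t : system_of_parameters m (a :: s) -> m t ->
  m `<=` addp (colon1 (seqid s) a) t -> multiplicity m <= 1.
Proof.
move=> sop mt mW; set P := seqid s; have hP : is_ideal P := seqid_ideal s.
have PW u w : m u -> colon1 P a w -> P (u * w).
  by move=> mu Ww; exact: colon_max Ww mu.
(* The exponents start at 2: an element of [m] is a multiple of t up to an error in W, and only a
   further factor from [m] moves this error into P. *)
have powP j : powid m j.+2 `<=` addp P (t ^+ j.+2).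
  elim: j => [|j IH]; apply: mul_sub; try exact: is_ideal_addp.
    move=> x y mx my1; have my : m y by rewrite -(powid1 hm).
    have [c Wc] := mW _ mx; have [d Wd] := mW _ my; exists (c * d).
    rewrite (_ : _ - _ = x * (y - t * d) + d * (t * (x - t * c))); last by rewrite expr2; ring.
    by apply: idealD; [|exact: PW|apply: idealM => //; exact: PW].
  move=> x y mx /IH[d Pd]; have [c Wc] := mW _ mx; exists (c * d).
  rewrite (_ : _ - _ = x * (y - t ^+ j.+2 * d) + t ^+ j.+1 * d * (t * (x - t * c))); last by rewrite !exprS; ring.
  by apply: idealD => //; apply: idealM => //; exact: PW.
(* This constant covers the values at 0, 1 and 2, so that the bound n + c holds from the start. *)
pose c := hilbert_mod P 2.
have stepP n : (hilbert_mod P n.+3 <= hilbert_mod P n.+2 + 1)%N.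
  have hX : is_ideal (idsum P (powid m n.+3)) by exact: idsum_powid_ideal.
  have XE : addp (idsum P (powid m n.+3)) (t ^+ n.+2) = idsum P (powid m n.+2).
    apply/seteqP; split.
      apply: addp_lub; first exact: idsum_powid_ideal.
        by move=> x [z Pz mz]; exists z => //; apply: powid_decr mz.
      by apply: idsum_subr => //; exact: powid_exp.
    move=> x [z Pz /powP[d Pd]]; exists d; apply: idsum_subl; first exact: powid_ideal.
    by rewrite (_ : _ - _ = x - z - t ^+ n.+2 * d + z); [apply: idealD|ring].
  have [_ le1] : finlen (idsum P (powid m n.+3)) (addp (idsum P (powid m n.+3)) (t ^+ n.+2)) /\
      (quot_length (idsum P (powid m n.+3)) (addp (idsum P (powid m n.+3)) (t ^+ n.+2)) <= 1)%N.
    apply: (finlen_addp_max noeA locA) => // u mu; apply: idsum_subr => //.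
    exact: (mul_mem mu (powid_exp n.+2 mt)).
  have fX := finlen_hilbert_mod n.+3 hP.
  rewrite /hilbert_mod (len_add fX (is_ideal_addp (t ^+ n.+2) hX)) //; last exact: addp_sub.
  by rewrite XE in le1 *; rewrite addnC leq_add2l.
have leP n : (hilbert_mod P n <= 'C(n + c, 1))%N.
  rewrite bin1; case: n => [|[|n]]; first by rewrite hilbert_mod0.
    apply: leq_trans (leq_addl _ _); apply: len_mono => //; first exact: finlen_hilbert_mod.
      exact: idsum_powid_ideal.
    by move=> x [z Pz mz]; exists z => //; apply: powid_decr mz.
  by elim: n => [|n IH]; [exact: leq_addl|have := stepP n; lia].
have ms y : y \in s -> m y by move=> ys; case: sop => _ + _; apply; rewrite inE ys orbT.
have le0 := hilbert_mod_bin ms leP.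
have dimE : krull_dim A = (1 + size s)%N by case: sop.
rewrite /multiplicity mulrC; have := @xgetPN {poly rat} 0 [set p : {poly rat} |
  exists N : nat, forall n : nat, (N <= n)%N ->
    p.[n%:R] = (quot_length (ideal_exp m n) setT)%:R].
rewrite -/(hilbert_samuel_poly m) => noP.
(* Should no such polynomial exist, [xget] returns 0 and the bound is trivial. *)
have [exP|/forallNP/noP->] := pselect (exists p : {poly rat}, exists N : nat, forall n : nat,
  (N <= n)%N -> p.[n%:R] = (quot_length (ideal_exp m n) setT)%:R); last by rewrite coef0 mul0r.
have [N pN] := xgetPex 0 exP; rewrite dimE -[1]/(1%:~R : rat).
apply: (poly_le_eventual_degree (N0 := N)) (eventual_degree_bin _ (c + size s)) _ => n Nn.
rewrite pN // ler0n /= -pmulrn ler_nat.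
apply: leq_trans (le0 n); rewrite /hilbert_mod (_ : idsum _ _ = powid m n) //.
apply/seteqP; split; last exact/idsum_subr/seqid_ideal.
by move=> x [z]; rewrite seqid_nil => ->; rewrite subr0.
Qed.

(** * Consequences of e(A) > 1 *)

Section LargeMultiplicity.
Hypothesis index_const : forall Q Q', parameter_ideal m Q -> parameter_ideal m Q' ->
  quot_length Q (ideal_colon Q m) = quot_length Q' (ideal_colon Q' m).
Hypothesis mult_gt1 : 1 < multiplicity m.

(** A unit in Q : m would force m <= Q = P + aA, hence m <= W + aA, contrary to e(A) > 1. *)
Lemma colon_sub_max a s : system_of_parameters m (a :: s) ->
  ideal_colon (seqid (a :: s)) m `<=` m.
Proof.
move=> sop x Ix; apply: contrapT => /(unit_notin noeA locA)[v xv].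
have ma : m a by case: sop => _ + _; apply; rewrite mem_head.
suff : multiplicity m <= 1 by rewrite leNgt mult_gt1.
apply: (multiplicity_le1 sop ma) => t mt.
have [c Pc] : addp (seqid s) a t.
  rewrite -seqid_cons -(mulr1 t) -xv mulrA [t * x]mulrC.
  by apply: idealMr; [exact: seqid_ideal|exact: Ix].
by exists c; apply: colon1_sub => //; exact: seqid_ideal.
Qed.

Lemma coef_mem_colon a s (x y z : A) : system_of_parameters m (a :: s) ->
  ideal_colon (seqid (a :: s)) m x -> ideal_colon (seqid (a :: s)) m y ->
  seqid s (x * y - a * z) -> ideal_colon (seqid (a :: s)) m z.
Proof.
move=> sop Ix Iy Pz; set P := seqid s; have hP : is_ideal P := seqid_ideal s.
apply: (socle_lift noeA locA buchA index_const sop) => t mt.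
have [u Pu] : addp P a (x * t) by rewrite /P -seqid_cons; exact: Ix.
have mu : m u.
  apply: contrapT => /(unit_notin noeA locA)[v uv].
  suff : multiplicity m <= 1 by rewrite leNgt mult_gt1.
  (* With v the inverse of u, x r = a c = x t v c modulo P. So x multiplies r - t v c into P, and
     therefore so does [a], which is x t v modulo P; that is, r - t v c lies in W. *)
  apply: (multiplicity_le1 sop mt) => r mr.
  have [c Pc] : addp P a (x * r) by rewrite /P -seqid_cons; exact: Ix.
  exists (v * c); rewrite /colon1 /= -/P.
  have Pxr : P (x * (r - t * (v * c))).
    rewrite (_ : _ * _ = (x * r - a * c) - (x * t - a * u) * (v * c) + a * c * (1 - u * v)); last by ring.
    by rewrite uv subrr mulr0 addr0; apply: idealB => //; apply: idealMr.
  rewrite (_ : a * _ = v * t * (x * (r - t * (v * c))) - v * (r - t * (v * c)) * (x * t - a * u)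
    + a * (r - t * (v * c)) * (1 - u * v)); last by ring.
  by rewrite uv subrr mulr0 addr0; apply: idealB => //; apply: idealM.
exists (u * y); first by rewrite mulrC; exact: Iy.
rewrite /colon1 /= -/P (_ : _ * _ = (x * t - a * u) * y - (x * y - a * z) * t); last by ring.
by apply: idealB => //; apply: idealMr.
Qed.

End LargeMultiplicity.
End MultiplicityOne.

Theorem mainTheorem7 (A : comNzRingType) (m : set A)
  (buchA : buchsbaum m)
  (dim_ge1 : (1 <= krull_dim A)%N)
  (index_indep : forall Q Q' : set A,
     parameter_ideal m Q -> parameter_ideal m Q' ->
     quot_length Q (ideal_colon Q m) = quot_length Q' (ideal_colon Q' m))
  (mult_gt1 : 1 < multiplicity m) :
  forall Q : set A, parameter_ideal m Q ->
    let I := ideal_colon Q m in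
    ideal_exp I 2 = ideal_mul Q I.
Proof.
case: buchA => noeA locA _ lenA _ [q [sop ->]]; rewrite -seqidE /=.
set I := ideal_colon _ _; have hQ := seqid_ideal q.
have hI : is_ideal I by exact: is_ideal_colon.
have QI : seqid q `<=` I by exact: colon_sub.
(* Any generator can be moved to the head, the others then forming the sequence that generates P. *)
have split_nth i : (i < size q)%N ->
    perm_eq q (q`_i :: take i q ++ drop i.+1 q).
  by move=> iq; rewrite -{1}(cat_take_drop i q) (drop_nth 0 iq) perm_catC /= perm_cons perm_catC.
rewrite -[ideal_mul I setT]/(powid I 1) powid1 //.
apply/seteqP; split; last exact: mul_subS.
apply: mul_sub; first exact: mul_ideal.
move=> x y Ix Iy.
have q0 : (0 < size q)%N by case: sop => ->.
(* This puts x y in Q, as y lies in Q : m. *)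
have mx : m x.
  have p0 := split_nth _ q0; have sop0 := sop_perm p0 sop.
  apply: (colon_sub_max noeA locA lenA mult_gt1 sop0).
  by rewrite -(seqid_eq (perm_mem p0)).
have [z xyE] : exists z : nat -> A, x * y = \sum_(i < size q) q`_i * z i.
  by apply: seqid_sum; rewrite mulrC; exact: Iy.
rewrite xyE; apply: ideal_sum; first exact: mul_ideal.
move=> i _; apply: mul_mem; first exact/seqid_mem/mem_nth.
have pi := split_nth _ (ltn_ord i); have sopi := sop_perm pi sop.
rewrite /I (seqid_eq (perm_mem pi)).
apply: (coef_mem_colon noeA locA lenA index_indep mult_gt1 sopi (x := x) (y := y)).
- by rewrite -(seqid_eq (perm_mem pi)).
- by rewrite -(seqid_eq (perm_mem pi)).
(* What remains of x y after removing the i-th term involves the other generators only, so it lies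
   in P. *)
rewrite xyE (bigD1 i) //= addrC addrK; apply: ideal_sum; first exact: seqid_ideal.
move=> j ji; apply: idealMr; first exact: seqid_ideal.
apply: seqid_mem; rewrite mem_cat; have [jlt|ilt|eq_ji] := ltngtP j i.
- by rewrite -(nth_take 0 jlt) mem_nth // size_take ltn_ord.
- apply/orP; right; rewrite -(subnKC ilt) -nth_drop mem_nth // size_drop.
  by rewrite ltn_sub2r // (leq_ltn_trans ilt).
- by case/eqP: ji; exact: val_inj.
Qed.
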